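(* Let $\gamma$ be a non-helical and non-planar Bertrand curve in Euclidean 3-space with mate $\widetilde\gamma$ (also non-helical and non-planar), and let $\gamma_n=N$ be its principal normal indicatrix, so that $\gamma_n=\epsilon\widetilde N$. Let $\widetilde f=\widetilde\tau/\widetilde\kappa$, $\widetilde g=\widetilde\tau'/\widetilde\kappa'$, where $'$ on $\widetilde\kappa,\widetilde\tau$ denotes $d/ds^{*}$, and $$\rho=\sqrt{\widetilde\kappa'^{2}(\widetilde g-\widetilde f)^{2}+\widetilde\kappa^{4}(1+\widetilde f^{2})^{3}}.$$ Then the Frenet frame $\{T_n,N_n,B_n\}$ of $\gamma_n$, with respect to its natural (arclength) parameter $s_n$, is $$T_n=\frac{-\epsilon}{\sqrt{1+\widetilde f^{2}}}\{\widetilde T-\widetilde f\widetilde B\},$$ $$N_n=\frac{\epsilon}{\rho\sqrt{1+\widetilde f^{2}}}\left\{\widetilde f\widetilde\kappa'(\widetilde g-\widetilde f)\widetilde T-\widetilde\kappa^{2}(1+\widetilde f^{2})^{2}\widetilde N+\widetilde\kappa'(\widetilde g-\widetilde f)\widetilde B\right\},$$ $$B_n=\frac1\rho\left\{\widetilde\kappa^{2}\widetilde f(1+\widetilde f^{2})\widetilde T+\widetilde\kappa'(\widetilde g-\widetilde f)\widetilde N+\widetilde\kappa^{2}(1+\widetilde f^{2})\widetilde B\right\},$$ and it satisfies $T_n'=\kappa_nN_n$, $N_n'=-\kappa_nT_n+\tau_nB_n$, $B_n'=-\tau_nN_n$ (derivatives with respect to $s_n$), where $$s_n=\int\frac{\widetilde\kappa(\widetilde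 g-\widetilde f)\sqrt{1+\widetilde f^{2}}}{\widetilde f\sqrt{1+\widetilde g^{2}}}\,ds,\qquad \kappa_n=\frac{\rho}{\widetilde\kappa^{2}(1+\widetilde f^{2})^{3/2}},$$ $$\tau_n=\frac{-\epsilon(\widetilde g-\widetilde f)}{\rho^{2}}\left\{(3\widetilde\kappa'^{2}-\widetilde\kappa\widetilde\kappa'')(1+\widetilde f^{2})+3\widetilde f\widetilde\kappa'^{2}(\widetilde g-\widetilde f)\right\}$$ are the arclength parameter, curvature and torsion of $\gamma_n$.
   Context: Curves are smooth regular curves in $\mathbb{R}^3$ with positive curvature; $\gamma$ is parameterized by arclength $s$ with Frenet frame $T,N,B$, and its mate $\widetilde\gamma$ by arclength $s^{*}$ with Frenet frame $\widetilde T,\widetilde N,\widetilde B$, curvature $\widetilde\kappa$, torsion $\widetilde\tau$. $\gamma$ is a Bertrand curve with Bertrand mate $\widetilde\gamma$ if there is a correspondence of points such that $N=\epsilon\widetilde N$ with $\epsilon=\pm1$ and $\widetilde\gamma(s^{*})=\gamma(s)+\lambda N(s)$ with $\lambda\neq0$ constant, i.e. $\gamma(s)=\widetilde\gamma(s^{*})-\lambda\epsilon\widetilde N$; here $\lambda=\frac{-\epsilon\widetilde g}{\widetilde\kappa(\widetilde g-\widetilde f)}$. The paper's convention relating the arclength parameters is $\frac{ds}{ds^{*}}=\frac{\widetilde f\sqrt{1+\widetilde g^{2}}}{\widetilde g-\widetilde f}$. Non-helical means that torsion/curvature is not constant, non-planar that the torsion is non-zero; it is assumed that $\widetilde\kappa'\neq0$,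 $\widetilde f\neq0$, $\widetilde g\neq\widetilde f$ at each point. The principal normal indicatrix of $\gamma$ is the curve $N(s)$ on the unit sphere. *)

(* Defs.v *)
(* Euclidean 3-space is R * R * R with Coquelicot's product normed-module
   structure. *)
From Stdlib Require Export Reals.
From Coquelicot Require Export Coquelicot.

Open Scope R_scope.

Notation R3 := (R * R * R)%type.

Definition cx (v : R3) : R := fst (fst v).
Definition cy (v : R3) : R := snd (fst v).
Definition cz (v : R3) : R := snd v.

Declare Scope vec_scope.
Delimit Scope vec_scope with V.
Notation "u +v w" := (plus (u : R3) (w : R3))
  (at level 50, left associativity) : vec_scope.
Notation "u -v w" := (minus (u : R3) (w : R3))
  (at level 50, left associativity) : vec_scope.
Notation "a *v u" := (scal (a : R) (u : R3))
  (at level 40, left associativity) : vec_scope.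
Open Scope vec_scope.

Definition dot (u v : R3) : R := cx u * cx v + cy u * cy v + cz u * cz v.

Definition enorm (u : R3) : R := sqrt (dot u u).

Definition cross (u v : R3) : R3 :=
  (cy u * cz v - cz u * cy v,
   cz u * cx v - cx u * cz v,
   cx u * cy v - cy u * cx v).

(* Nonempty, possibly unbounded. *)
Definition open_interval (I : R -> Prop) : Prop :=
  open I /\ (exists x, I x) /\
  (forall x y z, I x -> I z -> x <= y <= z -> I y).

Definition smooth_on (I : R -> Prop) (f : R -> R) : Prop :=
  forall (n : nat) (t : R), I t -> ex_derive_n f n t.

Definition smooth_curve_on (I : R -> Prop) (c : R -> R3) : Prop :=
  smooth_on I (fun t => cx (c t)) /\
  smooth_on I (fun t => cy (c t)) /\
  smooth_on I (fun t => cz (c t)).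

(* [Derive] is a total function; [velocity c t] is the derivative of [c] at [t]
   only where the coordinates are differentiable, e.g. for smooth curves. *)
Definition velocity (c : R -> R3) (t : R) : R3 :=
  (Derive (fun x => cx (c x)) t,
   Derive (fun x => cy (c x)) t,
   Derive (fun x => cz (c x)) t).

(* The Frenet formulas below are valid only for arclength parameterizations. *)
Definition frT (c : R -> R3) (s : R) : R3 := velocity c s.
Definition curvature (c : R -> R3) (s : R) : R := enorm (velocity (frT c) s).
Definition frN (c : R -> R3) (s : R) : R3 :=
  (/ curvature c s) *v velocity (frT c) s.
Definition frB (c : R -> R3) (s : R) : R3 := cross (frT c s) (frN c s).
(* Sign convention: N' = - curvature T + torsion B. *)
Definition torsion (c : R -> R3) (s : R) : R :=
  dot (velocity (frN c) s) (frB c s).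

Definition frenet_curve (I : R -> Prop) (c : R -> R3) : Prop :=
  open_interval I /\ smooth_curve_on I c /\
  (forall s, I s -> enorm (velocity c s) = 1) /\
  (forall s, I s -> 0 < curvature c s).

Definition tc_ratio (c : R -> R3) (s : R) : R := torsion c s / curvature c s.

Definition tc_deriv_ratio (c : R -> R3) (s : R) : R :=
  Derive (torsion c) s / Derive (curvature c) s.

Definition non_helical (I : R -> Prop) (c : R -> R3) : Prop :=
  ~ (exists a : R, forall s, I s -> tc_ratio c s = a).

Definition non_planar (I : R -> Prop) (c : R -> R3) : Prop :=
  forall s, I s -> torsion c s <> 0.

Definition correspondence (I I' : R -> Prop) (h k : R -> R) : Prop :=
  (forall s, I s -> I' (h s) /\ k (h s) = s) /\
  (forall t, I' t -> I (k t) /\ h (k t) = t).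

(* [h] sends the arclength s of [c] to the arclength s* of the corresponding
   point of the mate [c'], and [k] sends s* back to s. *)
Definition bertrand_mates (I : R -> Prop) (c : R -> R3)
    (I' : R -> Prop) (c' : R -> R3) (h k : R -> R) (eps lam : R) : Prop :=
  correspondence I I' h k /\
  (eps = 1 \/ eps = -1) /\
  lam <> 0 /\
  (forall s, I s -> frN c s = eps *v frN c' (h s)) /\
  (forall s, I s -> c' (h s) = c s +v lam *v frN c s).

(* [cn], defined on [J], is the curve [c] (in an arbitrary parameter on [I])
   re-expressed in terms of the arclength parameter [u = sg t]; [sg] may
   reverse orientation. *)
Definition arclength_reparam (I : R -> Prop) (c : R -> R3) (sg : R -> R)
    (J : R -> Prop) (cn : R -> R3) : Prop :=
  smooth_on I sg /\
  (forall t, I t -> Derive sg t <> 0) /\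
  (exists tau : R -> R, correspondence I J sg tau) /\
  (forall t, I t -> cn (sg t) = c t) /\
  (forall u, J u -> enorm (velocity cn u) = 1).

Definition rho (c : R -> R3) (s : R) : R :=
  let k := curvature c s in
  let k1 := Derive (curvature c) s in
  let f := tc_ratio c s in
  let g := tc_deriv_ratio c s in
  sqrt (k1 ^ 2 * (g - f) ^ 2 + k ^ 4 * (1 + f ^ 2) ^ 3).

(* ds / ds* as a function of s*, in terms of the mate [c']. *)
Definition ds_dsstar (c' : R -> R3) (t : R) : R :=
  let f := tc_ratio c' t in
  let g := tc_deriv_ratio c' t in
  f * sqrt (1 + g ^ 2) / (g - f).

(* ds_n / ds as a function of s*. *)
Definition dsn_ds (c' : R -> R3) (t : R) : R :=
  let k := curvature c' t in
  let f := tc_ratio c' t in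
  let g := tc_deriv_ratio c' t in
  k * (g - f) * sqrt (1 + f ^ 2) / (f * sqrt (1 + g ^ 2)).

(* Main.v *)
Require Import Defs.
From Stdlib Require Import Lra ClassicalEpsilon.

(* The vectors T', B' of the mate make constant angles with T, so differentiating
   gamma' = gamma + lambda N gives a linear relation between k' and tau' with
   constant coefficients; hence g is constant.  Since ds_n/ds* = k' sqrt(1 + f^2),
   the indicatrix eps N', reparameterized by s_n, is a curve written in the moving
   frame T', N', B', and the formulas follow by differentiating linear
   combinations of that frame.  The stated torsion uses that g is constant:
   without it a term in dg/ds* would appear. *)

(** * Inverse functions and smoothness on an interval *)

(** The arclength of the indicatrix is given only as an integral over [s], all formulas are in terms
    of [s*], and [sstar] is known only as the inverse of [s_of]. Smoothness of the reparameterized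
    curve therefore rests on inverting two functions with nonvanishing derivative on arbitrary open
    intervals, to all orders. Both [ds_dsstar] and [dsn_ds] may be negative, so increasing and
    decreasing functions must be treated. The two always have the same sign, however, and in their
    product the factors [f], [g - f] and [sqrt (1 + g^2)] cancel. The indicatrix thus runs in the
    direction of increasing [s*] in every case, which is why the signs in its Frenet frame do not
    depend on the orientation of the correspondence. *)

Lemma ivt_le (f : R -> R) (a b y : R) :
  a <= b -> (forall x, a <= x <= b -> continuity_pt f x) ->
  f a <= y <= f b -> exists c, a <= c <= b /\ f c = y.
Proof.
  intros ab cf [fa fb].
  destruct (Req_dec (f a) y) as [ea|na]; [exists a; split; [lra|exact ea]|].
  destruct (Req_dec (f b) y) as [eb|nb]; [exists b; split; [lra|exact eb]|].
  assert (ab' : a < b).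
  { destruct (Req_dec a b) as [e|]; [subst b; lra|lra]. }
  destruct (Ranalysis5.IVT_interv (fun x => f x - y) a b) as [z [hz1 hz2]];
    [|exact ab'|lra|lra|].
  - intros x hx. apply continuity_pt_minus; [now apply cf|].
    now apply continuity_pt_const.
  - exists z. split; [exact hz1|lra].
Qed.

(** What is known is the order of the values, so [a] and [b] may come in either order; the reversed
    one is the previous lemma for [- f]. *)
Lemma ivt_on (I : R -> Prop) (f : R -> R) (a b y : R) :
  open_interval I -> (forall x, I x -> continuity_pt f x) ->
  I a -> I b -> f a <= y <= f b ->
  exists c, I c /\ Rmin a b <= c <= Rmax a b /\ f c = y.
Proof.
  intros (_ & _ & conv) cf ha hb hy.
  destruct (Rle_dec a b) as [ab|ba].
  - rewrite Rmin_left, Rmax_right by lra.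
    destruct (ivt_le f a b y) as (c & hc & ec); trivial.
    + intros x hx. apply cf, (conv a x b); trivial.
    + exists c. repeat split; trivial; try lra. now apply (conv a c b).
  - rewrite Rmin_right, Rmax_left by lra.
    destruct (ivt_le (fun x => - f x) b a (- y)) as (c & hc & ec); try lra.
    + intros x hx. apply continuity_pt_opp, cf, (conv b x a); trivial.
    + exists c. repeat split; try lra. now apply (conv b c a).
Qed.

Lemma is_derive_continuity_pt (f : R -> R) (x l : R) :
  is_derive f x l -> continuity_pt f x.
Proof.
  intros h. apply derivable_continuous_pt. exists l. now apply is_derive_Reals.
Qed.

Lemma open_radius (I : R -> Prop) (t : R) :
  open_interval I -> I t ->
  exists d, 0 < d /\ forall x, t - d <= x <= t + d -> I x.
Proof.
  intros (op & _) ht. destruct (op t ht) as [d hd].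
  exists (d / 2). pose proof (cond_pos d). split; [lra|].
  intros x hx. apply hd. apply Rabs_def1; simpl; unfold minus, plus, opp; simpl; lra.
Qed.

Lemma increasing_on (I : R -> Prop) (f df : R -> R) :
  open_interval I -> (forall t, I t -> is_derive f t (df t)) ->
  (forall t, I t -> 0 < df t) ->
  forall x y, I x -> I y -> x < y -> f x < f y.
Proof.
  intros (_ & _ & conv) hf pos x y hx hy xy.
  destruct (MVT_gen f x y df) as (c & hc & ec).
  - intros z hz. apply hf. rewrite Rmin_left, Rmax_right in hz by lra.
    apply (conv x z y); trivial; lra.
  - intros z hz. rewrite Rmin_left, Rmax_right in hz by lra.
    apply (is_derive_continuity_pt f z (df z)), hf.
    apply (conv x z y); trivial; lra.
  - rewrite Rmin_left, Rmax_right in hc by lra.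
    assert (0 < df c) by (apply pos, (conv x c y); trivial; lra).
    assert (0 < df c * (y - x)) by (apply Rmult_lt_0_compat; lra). lra.
Qed.

(** [g] is assumed only to undo [f] on [I]. By the intermediate value theorem every value between
    [f (t - e)] and [f (t + e)] is attained between [t - e] and [t + e]; hence [g] inverts [f] on
    both sides near [f t] and is continuous there, as the reciprocal rule requires. *)
Lemma inverse_derive_pos (I : R -> Prop) (f df g : R -> R) :
  open_interval I -> (forall t, I t -> is_derive f t (df t)) ->
  (forall t, I t -> 0 < df t) -> (forall t, I t -> g (f t) = t) ->
  forall t, I t ->
  locally (f t) (fun u => exists x, I x /\ f x = u) /\
  is_derive g (f t) (/ df t).
Proof.
  intros oi hf pos gf t ht.
  pose proof (increasing_on I f df oi hf pos) as incr.
  assert (cf : forall x, I x -> continuity_pt f x).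
  { intros x hx. apply (is_derive_continuity_pt f x (df x)). now apply hf. }
  destruct (open_radius I t oi ht) as (d & dp & hd).
  assert (surj : forall e u, 0 < e <= d -> f (t - e) <= u <= f (t + e) ->
     exists x, I x /\ t - e <= x <= t + e /\ f x = u).
  { intros e u he hu. destruct (ivt_on I f (t - e) (t + e) u) as (c & hc); trivial.
    - apply hd; lra.
    - apply hd; lra.
    - rewrite Rmin_left, Rmax_right in hc by lra. now exists c. }
  assert (nb : forall e, 0 < e <= d -> f (t - e) < f t < f (t + e)).
  { intros e he. split; apply incr; trivial; try lra; apply hd; lra. }
  assert (loc : forall e, 0 < e <= d ->
     locally (f t) (fun u => f (t - e) <= u <= f (t + e))).
  { intros e he. destruct (nb e he) as [n1 n2].
    assert (p : 0 < Rmin (f t - f (t - e)) (f (t + e) - f t)).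
    { apply Rmin_glb_lt; lra. }
    exists (mkposreal _ p). intros u hu.
    apply Rabs_def2 in hu. simpl in hu. unfold minus, plus, opp in hu; simpl in hu.
    pose proof (Rmin_l (f t - f (t - e)) (f (t + e) - f t)).
    pose proof (Rmin_r (f t - f (t - e)) (f (t + e) - f t)). lra. }
  split.
  { apply (filter_imp (fun u => f (t - d) <= u <= f (t + d))); [|apply loc; lra].
    intros u hu. destruct (surj d u) as (x & hx & _ & ex); trivial; [lra|].
    now exists x. }
  assert (cg : continuity_pt g (f t)).
  { apply continuity_pt_filterlim, filterlim_locally. intros e. rewrite gf by trivial.
    assert (ep : 0 < Rmin d (e / 2)).
    { apply Rmin_glb_lt; trivial. pose proof (cond_pos e); lra. }
    pose proof (Rmin_l d (e / 2)). pose proof (Rmin_r d (e / 2)).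
    apply (filter_imp (fun u => f (t - Rmin d (e / 2)) <= u <= f (t + Rmin d (e / 2)))).
    2: apply loc; lra.
    intros u hu. destruct (surj _ u (conj ep (Rmin_l _ _)) hu) as (x & hx & hx2 & ex).
    rewrite <- ex, gf by trivial. pose proof (cond_pos e).
    apply Rabs_def1; unfold minus, plus, opp; simpl; lra. }
  destruct (nb d) as [n1 n2]; [lra|].
  apply is_derive_Reals.
  assert (Il : I (t - d)) by (apply hd; lra).
  assert (Ir : I (t + d)) by (apply hd; lra).
  assert (prf : forall a, g (f (t - d)) <= a <= g (f (t + d)) -> derivable_pt f a).
  { intros a ha. rewrite !gf in ha by trivial. exists (df a).
    apply is_derive_Reals, hf, hd; lra. }
  assert (prg : g (f (t - d)) <= g (f t) <= g (f (t + d))).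
  { rewrite !gf by trivial. lra. }
  assert (ed : derive_pt f (g (f t)) (prf _ prg) = df t).
  { rewrite derive_pt_eq, gf by trivial. now apply is_derive_Reals, hf. }
  pose proof (Ranalysis5.derivable_pt_lim_recip_interv f g _ _ _ prf cg
    ltac:(lra) (conj n1 n2) prg) as H.
  rewrite ed in H. unfold Rdiv in H. rewrite Rmult_1_l in H. apply H.
  - intros u hu. unfold comp, id.
    destruct (surj d u) as (x & hx & _ & ex); trivial; [lra|].
    rewrite <- ex, gf; trivial.
  - specialize (pos t ht). lra.
Qed.

(** Applied to a derivative, this decides between increasing and decreasing. *)
Lemma constant_sign (I : R -> Prop) (f : R -> R) :
  open_interval I -> (forall x, I x -> continuity_pt f x) ->
  (forall x, I x -> f x <> 0) ->
  (forall x, I x -> 0 < f x) \/ (forall x, I x -> f x < 0).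
Proof.
  intros oi cf nz. destruct oi as (op & (a & ha) & conv).
  assert (oi : open_interval I) by (repeat split; trivial; now exists a).
  destruct (Rlt_dec 0 (f a)) as [p|n].
  - left. intros x hx. destruct (Rlt_dec 0 (f x)) as [|n]; trivial. exfalso.
    destruct (ivt_on I f x a 0) as (c & hc & _ & ec); trivial; try lra.
    now apply (nz c).
  - right. intros x hx. destruct (Rlt_dec (f x) 0) as [|n']; trivial. exfalso.
    destruct (ivt_on I f a x 0) as (c & hc & _ & ec); trivial; try lra.
    now apply (nz c).
Qed.

(** When [df] is negative, the increasing case applies to [- f], whose inverse is [g] composed with
    negation. *)
Lemma inverse_derive (I : R -> Prop) (f df g : R -> R) :
  open_interval I -> (forall t, I t -> is_derive f t (df t)) ->
  (forall t, I t -> continuity_pt df t) ->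
  (forall t, I t -> df t <> 0) -> (forall t, I t -> g (f t) = t) ->
  forall t, I t ->
  locally (f t) (fun u => exists x, I x /\ f x = u) /\
  is_derive g (f t) (/ df t).
Proof.
  intros oi hf cdf nz gf t ht.
  destruct (constant_sign I df oi cdf nz) as [p|n].
  { now apply (inverse_derive_pos I). }
  destruct (inverse_derive_pos I (fun x => - f x) (fun x => - df x)
     (fun u => g (- u))) with (t := t) as [h1 h2]; trivial.
  - intros x hx. apply (is_derive_opp f x (df x)). now apply hf.
  - intros x hx. specialize (n x hx). lra.
  - intros x hx. rewrite Ropp_involutive. now apply gf.
  - split.
    + destruct h1 as [e he]. exists e. intros u hu.
      destruct (he (- u)) as (x & hx & ex).
      * apply Rabs_def2 in hu. unfold minus, plus, opp in hu; simpl in hu.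
        apply Rabs_def1; unfold minus, plus, opp; simpl; lra.
      * exists x. split; trivial. lra.
    + apply (is_derive_ext (fun u => g (- - u))).
      { intros u. now rewrite Ropp_involutive. }
      replace (/ df t) with (scal (-1) (/ - df t)).
      2: { unfold scal; simpl; unfold mult; simpl. field. now apply nz. }
      apply (is_derive_comp (fun u => g (- u)) (fun u => - u) (f t)).
      * exact h2.
      * apply (is_derive_opp (fun u => u) (f t) 1), (is_derive_id (K := R_AbsRing)).
Qed.

(** The image is an interval by the intermediate value theorem and open because values near an
    attained one are attained; injectivity comes from strict monotonicity. *)
Lemma inverse_bijection (I : R -> Prop) (f df : R -> R) :
  open_interval I -> (forall t, I t -> is_derive f t (df t)) ->
  (forall t, I t -> continuity_pt df t) -> (forall t, I t -> df t <> 0) ->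
  let J := fun u => exists x, I x /\ f x = u in
  open_interval J /\ exists g, correspondence I J f g.
Proof.
  intros oi hf cdf nz J.
  assert (inj : forall x y, I x -> I y -> f x = f y -> x = y).
  { assert (lt : forall x y, I x -> I y -> x < y -> f x <> f y).
    { intros x y hx hy xy. destruct (constant_sign I df oi cdf nz) as [p|n].
      - pose proof (increasing_on I f df oi hf p x y hx hy xy). lra.
      - assert (- f x < - f y); [|lra].
        apply (increasing_on I (fun x => - f x) (fun x => - df x) oi); trivial.
        + intros z hz. apply (is_derive_opp f z (df z)). now apply hf.
        + intros z hz. specialize (n z hz). lra. }
    intros x y hx hy e. destruct (Rtotal_order x y) as [l|[l|l]]; trivial.
    - destruct (lt x y hx hy l e).
    - destruct (lt y x hy hx l). now symmetry. }
  (* The inverse has no formula and is obtained by choice; outside [J] its value is arbitrary. *)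
  set (g := fun u => epsilon (inhabits 0) (fun x => I x /\ f x = u)).
  assert (hg : forall u, J u -> I (g u) /\ f (g u) = u).
  { intros u hu. exact (epsilon_spec (inhabits 0) (fun x => I x /\ f x = u) hu). }
  assert (gf : forall t, I t -> J (f t) /\ g (f t) = t).
  { intros t ht. assert (Jt : J (f t)) by now exists t.
    split; trivial. apply inj; trivial; now apply hg. }
  split; [|now exists g].
  split; [|split].
  - intros u (x & hx & <-).
    apply (inverse_derive I f df g); trivial. intros t ht. now apply gf.
  - destruct oi as (_ & (x & hx) & _). exists (f x). now exists x.
  - intros x y z (a & ha & <-) (b & hb & <-) hy.
    destruct (ivt_on I f a b y) as (c & hc & _ & ec); trivial.
    + intros x hx. apply (is_derive_continuity_pt f x (df x)). now apply hf.
    + now exists c.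
Qed.

(* Carrying the derivative as a witness makes closure under products, inverses
   and composition a direct induction, unlike for [ex_derive_n]. *)
Fixpoint diff_on (I : R -> Prop) (n : nat) (f : R -> R) : Prop :=
  match n with
  | O => True
  | S m => exists df, (forall t, I t -> is_derive f t (df t)) /\ diff_on I m df
  end.

Lemma diff_on_pred I n f : diff_on I (S n) f -> diff_on I n f.
Proof.
  revert f. induction n as [|n IH]; intros f; [now simpl|].
  intros (df & h & hn). exists df. split; trivial. now apply IH.
Qed.

Lemma diff_on_ext (I : R -> Prop) n f g :
  open I -> (forall t, I t -> f t = g t) -> diff_on I n f -> diff_on I n g.
Proof.
  destruct n as [|n]; [now simpl|]. intros op e (df & h & hn).
  exists df. split; trivial. intros t ht.
  apply (is_derive_ext_loc f); [|now apply h].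
  apply (filter_imp I); trivial. now apply op.
Qed.

Lemma smooth_diff_on I f n : smooth_on I f -> diff_on I n f.
Proof.
  revert f. induction n as [|n IH]; intros f hf; [exact Logic.I|].
  exists (Derive f). split.
  - intros t ht. apply Derive_correct, (hf 1%nat t ht).
  - apply IH. intros [|m] t ht; [exact Logic.I|].
    specialize (hf (S (S m)) t ht). revert hf. simpl.
    apply ex_derive_ext. intros x.
    (* [Derive_n] adds derivatives on the outside, whereas the induction strips the innermost
       one. *)
    change (Derive_n f (S m) x = Derive_n (Derive_n f 1) m x).
    now rewrite (Derive_n_comp f m 1 x), Nat.add_comm.
Qed.

Lemma diff_on_derive_n I n f :
  open I -> diff_on I n f -> forall t, I t -> ex_derive_n f n t.
Proof.
  intros op. revert f. induction n as [|n IH]; intros f hf t ht; [exact Logic.I|].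
  destruct hf as (df & h & hn). destruct n as [|n].
  - exists (df t). now apply h.
  - apply (ex_derive_ext_loc (Derive_n df n)); [|exact (IH df hn t ht)].
    apply (filter_imp I); [|now apply op]. intros x hx.
    change (Derive_n df n x = Derive_n f (S n) x).
    rewrite <- (Nat.add_1_r n), <- (Derive_n_comp f n 1 x). apply Derive_n_ext_loc.
    apply (filter_imp I); [|now apply op]. intros y hy.
    symmetry. now apply is_derive_unique, h.
Qed.

Lemma smooth_onP (I : R -> Prop) f : open I -> smooth_on I f <-> forall n, diff_on I n f.
Proof.
  intros op. split.
  - intros h n. now apply smooth_diff_on.
  - intros h n t ht. now apply (diff_on_derive_n I).
Qed.

Lemma diff_on_const I n c : diff_on I n (fun _ => c).
Proof.
  revert c. induction n as [|n IH]; intros c; [exact Logic.I|].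
  exists (fun _ => 0). split; trivial. intros t _. apply @is_derive_const.
Qed.

Lemma diff_on_plus I n f g :
  diff_on I n f -> diff_on I n g -> diff_on I n (fun t => f t + g t).
Proof.
  revert f g. induction n as [|n IH]; intros f g; [now simpl|].
  intros (df & hf & nf) (dg & hg & ng). exists (fun t => df t + dg t).
  split; [|now apply IH]. intros t ht. apply @is_derive_plus; auto.
Qed.

Lemma diff_on_mult I n f g :
  diff_on I n f -> diff_on I n g -> diff_on I n (fun t => f t * g t).
Proof.
  revert f g. induction n as [|n IH]; intros f g; [now simpl|].
  intros hf hg. pose proof (diff_on_pred _ _ _ hf). pose proof (diff_on_pred _ _ _ hg).
  destruct hf as (df & hf & nf), hg as (dg & hg & ng).
  exists (fun t => df t * g t + f t * dg t). split.
  - intros t ht. apply @is_derive_mult; auto. exact Rmult_comm.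
  - apply diff_on_plus; now apply IH.
Qed.

(** The derivative of [/ f] is built from [df] and from [/ f] again, which the induction hypothesis
    covers at one order less. The square root below works alike. *)
Lemma diff_on_inv I n f :
  (forall t, I t -> f t <> 0) -> diff_on I n f -> diff_on I n (fun t => / f t).
Proof.
  intros nz. induction n as [|n IH]; [now simpl|].
  intros hf. pose proof (IH (diff_on_pred _ _ _ hf)).
  destruct hf as (df & hf & nf).
  exists (fun t => (-1) * df t * (/ f t * / f t)). split.
  - intros t ht. replace (-1 * df t * (/ f t * / f t)) with (- df t / f t ^ 2).
    + apply is_derive_inv; auto.
    + field. now apply nz.
  - repeat apply diff_on_mult; trivial. apply diff_on_const.
Qed.

Lemma diff_on_sqrt I n f :
  (forall t, I t -> 0 < f t) -> diff_on I n f -> diff_on I n (fun t => sqrt (f t)).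
Proof.
  intros pos. induction n as [|n IH]; [now simpl|].
  intros hf. pose proof (IH (diff_on_pred _ _ _ hf)).
  destruct hf as (df & hf & nf).
  exists (fun t => df t * / (2 * sqrt (f t))). split.
  - intros t ht. apply (is_derive_sqrt f t (df t)); auto.
  - apply diff_on_mult; trivial. apply diff_on_inv.
    + intros t ht. pose proof (sqrt_lt_R0 _ (pos t ht)). lra.
    + apply diff_on_mult; trivial. apply diff_on_const.
Qed.

Lemma diff_on_comp (I J : R -> Prop) n f h :
  (forall t, I t -> J (h t)) -> diff_on J n f -> diff_on I n h ->
  diff_on I n (fun t => f (h t)).
Proof.
  intros ij. revert f h ij. induction n as [|n IH]; intros f h ij; [now simpl|].
  intros hf hh. pose proof (diff_on_pred _ _ _ hh).
  destruct hf as (df & hf & nf), hh as (dh & hh & nh).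
  exists (fun t => dh t * df (h t)). split.
  - intros t ht. apply (is_derive_comp f h t (df (h t)) (dh t)); auto.
  - apply diff_on_mult; trivial. now apply IH.
Qed.

(** Bootstrapping: the derivative [/ df (g u)] has as many derivatives as [g] is known to have, so
    each order for [g] yields the next. *)
Lemma diff_on_inverse (I J : R -> Prop) n f df g :
  correspondence I J f g ->
  (forall u, J u -> is_derive g u (/ df (g u))) ->
  (forall t, I t -> df t <> 0) -> diff_on I n df -> diff_on J n g.
Proof.
  intros (fg & gf) hg nz. induction n as [|n IH]; [now simpl|].
  intros hn. pose proof (IH (diff_on_pred _ _ _ hn)) as ng.
  exists (fun u => / df (g u)). split; trivial.
  apply diff_on_inv.
  - intros u hu. apply nz. now apply gf.
  - apply diff_on_comp with I; trivial; [|now apply diff_on_pred].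
    intros u hu. now apply gf.
Qed.

Section SmoothClosure.
Context {I : R -> Prop} (op : open I).

Lemma smooth_ext f g :
  (forall t, I t -> f t = g t) -> smooth_on I f -> smooth_on I g.
Proof.
  intros e hf. apply smooth_onP; trivial. intros n.
  apply diff_on_ext with f; trivial. now apply smooth_onP.
Qed.

Lemma smooth_const c : smooth_on I (fun _ => c).
Proof. apply smooth_onP; trivial. intros n. apply diff_on_const. Qed.

Lemma smooth_plus f g :
  smooth_on I f -> smooth_on I g -> smooth_on I (fun t => f t + g t).
Proof.
  intros hf hg. apply smooth_onP; trivial. intros n.
  apply diff_on_plus; now apply smooth_onP.
Qed.

Lemma smooth_mult f g :
  smooth_on I f -> smooth_on I g -> smooth_on I (fun t => f t * g t).
Proof.
  intros hf hg. apply smooth_onP; trivial. intros n.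
  apply diff_on_mult; now apply smooth_onP.
Qed.

Lemma smooth_minus f g :
  smooth_on I f -> smooth_on I g -> smooth_on I (fun t => f t - g t).
Proof.
  intros hf hg. apply smooth_ext with (fun t => f t + (-1) * g t).
  - intros t _. ring.
  - apply smooth_plus; trivial. apply smooth_mult; trivial. apply smooth_const.
Qed.

Lemma smooth_inv f :
  (forall t, I t -> f t <> 0) -> smooth_on I f -> smooth_on I (fun t => / f t).
Proof.
  intros nz hf. apply smooth_onP; trivial. intros n.
  apply diff_on_inv; trivial. now apply smooth_onP.
Qed.

Lemma smooth_div f g :
  (forall t, I t -> g t <> 0) -> smooth_on I f -> smooth_on I g ->
  smooth_on I (fun t => f t / g t).
Proof. intros nz hf hg. apply smooth_mult; trivial. now apply smooth_inv. Qed.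

Lemma smooth_sqrt f :
  (forall t, I t -> 0 < f t) -> smooth_on I f -> smooth_on I (fun t => sqrt (f t)).
Proof.
  intros pos hf. apply smooth_onP; trivial. intros n.
  apply diff_on_sqrt; trivial. now apply smooth_onP.
Qed.

Lemma smooth_pow f k : smooth_on I f -> smooth_on I (fun t => f t ^ k).
Proof.
  intros hf. induction k as [|k IH]; simpl.
  - apply smooth_const.
  - now apply smooth_mult.
Qed.

Lemma smooth_comp (J : R -> Prop) f h :
  (forall t, I t -> J (h t)) -> smooth_on J f -> smooth_on I h ->
  smooth_on I (fun t => f (h t)).
Proof.
  intros ij hf hh. apply smooth_onP; trivial. intros n.
  apply diff_on_comp with J; trivial; now apply smooth_diff_on.
Qed.

Lemma smooth_primitive f df :
  (forall t, I t -> is_derive f t (df t)) -> smooth_on I df -> smooth_on I f.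
Proof.
  intros h hd. apply smooth_onP; trivial. intros [|n]; [exact Logic.I|].
  exists df. split; trivial. now apply smooth_diff_on.
Qed.

Lemma smooth_Derive f : smooth_on I f -> smooth_on I (Derive f).
Proof.
  intros hf. apply smooth_onP; trivial. intros n.
  destruct (smooth_diff_on I f (S n) hf) as (df & h & hn).
  apply diff_on_ext with df; trivial.
  intros t ht. symmetry. now apply is_derive_unique, h.
Qed.

Lemma smooth_is_derive f t : smooth_on I f -> I t -> is_derive f t (Derive f t).
Proof. intros hf ht. apply Derive_correct, (hf 1%nat t ht). Qed.

Lemma smooth_continuity_pt f t : smooth_on I f -> I t -> continuity_pt f t.
Proof.
  intros hf ht. apply (is_derive_continuity_pt f t (Derive f t)).
  now apply smooth_is_derive.
Qed.

End SmoothClosure.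

Lemma smooth_inverse (I J : R -> Prop) f df g :
  open_interval I -> open J -> correspondence I J f g ->
  (forall t, I t -> is_derive f t (df t)) -> (forall t, I t -> df t <> 0) ->
  smooth_on I df ->
  smooth_on J g /\ forall u, J u -> is_derive g u (/ df (g u)).
Proof.
  intros oi oj cor hf nz sdf.
  assert (hg : forall u, J u -> is_derive g u (/ df (g u))).
  { intros u hu. destruct (proj2 cor u hu) as [h1 h2].
    rewrite <- h2 at 1. apply (inverse_derive I f df g oi); trivial.
    - intros t ht. now apply (@smooth_continuity_pt I).
    - intros t ht. now apply cor. }
  split; trivial. apply smooth_onP; trivial. intros n.
  apply (diff_on_inverse I J n f df g); trivial. now apply smooth_diff_on.
Qed.

(** * Curves in space and the Frenet formulas *)

Lemma R3_ext (u v : R3) : cx u = cx v -> cy u = cy v -> cz u = cz v -> u = v.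
Proof.
  destruct u as [[x y] z], v as [[x' y'] z']. unfold cx, cy, cz. simpl.
  now intros -> -> ->.
Qed.

Lemma cx_plus (u v : R3) : cx (u +v v) = cx u + cx v. Proof. reflexivity. Qed.
Lemma cy_plus (u v : R3) : cy (u +v v) = cy u + cy v. Proof. reflexivity. Qed.
Lemma cz_plus (u v : R3) : cz (u +v v) = cz u + cz v. Proof. reflexivity. Qed.
Lemma cx_minus (u v : R3) : cx (u -v v) = cx u - cx v. Proof. reflexivity. Qed.
Lemma cy_minus (u v : R3) : cy (u -v v) = cy u - cy v. Proof. reflexivity. Qed.
Lemma cz_minus (u v : R3) : cz (u -v v) = cz u - cz v. Proof. reflexivity. Qed.
Lemma cx_scal a (v : R3) : cx (a *v v) = a * cx v. Proof. reflexivity. Qed.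
Lemma cy_scal a (v : R3) : cy (a *v v) = a * cy v. Proof. reflexivity. Qed.
Lemma cz_scal a (v : R3) : cz (a *v v) = a * cz v. Proof. reflexivity. Qed.
Lemma cx_cross u v : cx (cross u v) = cy u * cz v - cz u * cy v. Proof. reflexivity. Qed.
Lemma cy_cross u v : cy (cross u v) = cz u * cx v - cx u * cz v. Proof. reflexivity. Qed.
Lemma cz_cross u v : cz (cross u v) = cx u * cy v - cy u * cx v. Proof. reflexivity. Qed.

Ltac coords := rewrite ?cx_plus, ?cy_plus, ?cz_plus, ?cx_minus, ?cy_minus, ?cz_minus,
  ?cx_scal, ?cy_scal, ?cz_scal, ?cx_cross, ?cy_cross, ?cz_cross.
Ltac vec_eq := apply R3_ext; repeat (progress coords).

Lemma dot_comm u v : dot u v = dot v u.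
Proof. unfold dot. ring. Qed.

Lemma dot_scal_l a u v : dot (a *v u) v = a * dot u v.
Proof. unfold dot. coords. ring. Qed.

Lemma dot_cross_l u v : dot u (cross u v) = 0.
Proof. unfold dot. coords. ring. Qed.

Lemma dot_cross_r u v : dot v (cross u v) = 0.
Proof. unfold dot. coords. ring. Qed.

(** Lagrange's identity. *)
Lemma dot_self_cross u v : dot (cross u v) (cross u v) = dot u u * dot v v - dot u v ^ 2.
Proof. unfold dot. coords. ring. Qed.

Lemma dot_self_nonneg u : 0 <= dot u u.
Proof.
  unfold dot. pose proof (Rle_0_sqr (cx u)). pose proof (Rle_0_sqr (cy u)).
  pose proof (Rle_0_sqr (cz u)). unfold Rsqr in *. lra.
Qed.

Lemma enorm_sqr u : enorm u * enorm u = dot u u.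
Proof. apply sqrt_sqrt, dot_self_nonneg. Qed.

Lemma orthonormal_expansion u v x :
  dot u u = 1 -> dot v v = 1 -> dot u v = 0 ->
  x = dot x u *v u +v dot x v *v v +v dot x (cross u v) *v cross u v.
Proof.
  intros uu vv uv.
  (* b x (x x b) for b = u x v, expanded by the triple product formula *)
  assert (e : (dot u u * dot v v - dot u v ^ 2) *v x =
    dot x u *v (dot v v *v u -v dot u v *v v) +v
    dot x v *v (dot u u *v v -v dot u v *v u) +v
    dot x (cross u v) *v cross u v).
  { vec_eq; unfold dot; coords; ring. }
  rewrite uu, vv, uv in e.
  apply R3_ext; [apply (f_equal cx) in e|apply (f_equal cy) in e|apply (f_equal cz) in e];
    revert e; repeat (progress coords); intros e; lra.
Qed.

Section DerivePair.
Context {U V : NormedModule R_AbsRing}.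

Lemma is_derive_fst (c : R -> U * V) (t : R) (a : U) (b : V) :
  is_derive c t (a, b) -> is_derive (fun x => fst (c x)) t a.
Proof.
  intros h. exact (filterdiff_comp' c fst t _ _ h (filterdiff_linear _ is_linear_fst)).
Qed.

Lemma is_derive_snd (c : R -> U * V) (t : R) (a : U) (b : V) :
  is_derive c t (a, b) -> is_derive (fun x => snd (c x)) t b.
Proof.
  intros h. exact (filterdiff_comp' c snd t _ _ h (filterdiff_linear _ is_linear_snd)).
Qed.

Lemma is_derive_pair (f : R -> U) (g : R -> V) (t : R) (a : U) (b : V) :
  is_derive f t a -> is_derive g t b -> is_derive (fun x => (f x, g x)) t (a, b).
Proof.
  intros hf hg.
  apply (@filterdiff_comp_2 _ _ U V (prod_NormedModule R_AbsRing U V) (locally t) _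
    f g pair _ _ pair hf hg).
  (* Uncurried, [pair] is the identity of the product space, hence its own differential. *)
  apply (filterdiff_ext_lin _ (fun p => p)); [|now intros [y z]].
  apply (filterdiff_ext (fun p => p)); [now intros [y z]|].
  apply filterdiff_id.
Qed.

End DerivePair.

Lemma is_derive_R3 (c : R -> R3) t v :
  is_derive c t v <->
  is_derive (fun x => cx (c x)) t (cx v) /\ is_derive (fun x => cy (c x)) t (cy v) /\
  is_derive (fun x => cz (c x)) t (cz v).
Proof.
  split.
  - intros h. destruct v as [[v1 v2] v3].
    split; [|split].
    + exact (is_derive_fst _ _ _ _ (is_derive_fst _ _ _ _ h)).
    + exact (is_derive_snd _ _ _ _ (is_derive_fst _ _ _ _ h)).
    + exact (is_derive_snd _ _ _ _ h).
  - intros (hx & hy & hz).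
    pose proof (is_derive_pair _ _ _ _ _ (is_derive_pair _ _ _ _ _ hx hy) hz) as h.
    destruct v as [[v1 v2] v3].
    apply (is_derive_ext (fun x => (cx (c x), cy (c x), cz (c x)))); [|exact h].
    intros x. now destruct (c x) as [[a b] d].
Qed.

Lemma velocity_unique c t v : is_derive c t v -> velocity c t = v.
Proof.
  intros h. apply is_derive_R3 in h. destruct h as (hx & hy & hz).
  apply R3_ext; now apply is_derive_unique.
Qed.

Lemma smooth_curve_is_derive (I : R -> Prop) c t :
  smooth_curve_on I c -> I t -> is_derive c t (velocity c t).
Proof.
  intros (hx & hy & hz) ht. apply is_derive_R3.
  split; [|split]; apply (@smooth_is_derive I); trivial.
Qed.

(** Stated with the operations of [R] rather than those of a normed module, so that the resulting
    derivatives are open to [ring]. *)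
Lemma is_derive_plus_R (f g : R -> R) t a b :
  is_derive f t a -> is_derive g t b -> is_derive (fun x => f x + g x) t (a + b).
Proof. apply @is_derive_plus. Qed.

Lemma is_derive_minus_R (f g : R -> R) t a b :
  is_derive f t a -> is_derive g t b -> is_derive (fun x => f x - g x) t (a - b).
Proof. apply @is_derive_minus. Qed.

Lemma is_derive_mult_R (f g : R -> R) t a b :
  is_derive f t a -> is_derive g t b ->
  is_derive (fun x => f x * g x) t (a * g t + f t * b).
Proof. intros hf hg. apply @is_derive_mult; trivial. exact Rmult_comm. Qed.

Lemma is_derive_eq (f : R -> R) (t a b : R) :
  is_derive f t a -> @eq R a b -> is_derive f t b.
Proof. now intros h <-. Qed.

Lemma is_derive_dot (c d : R -> R3) t u v :
  is_derive c t u -> is_derive d t v ->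
  is_derive (fun x => dot (c x) (d x)) t (dot u (d t) + dot (c t) v).
Proof.
  intros hc hd. apply is_derive_R3 in hc. apply is_derive_R3 in hd.
  destruct hc as (c1 & c2 & c3), hd as (d1 & d2 & d3). unfold dot.
  apply (is_derive_eq _ _ _ _ (is_derive_plus_R _ _ _ _ _
    (is_derive_plus_R _ _ _ _ _ (is_derive_mult_R _ _ _ _ _ c1 d1)
       (is_derive_mult_R _ _ _ _ _ c2 d2)) (is_derive_mult_R _ _ _ _ _ c3 d3))).
  ring.
Qed.

Lemma is_derive_cross (c d : R -> R3) t u v :
  is_derive c t u -> is_derive d t v ->
  is_derive (fun x => cross (c x) (d x)) t (cross u (d t) +v cross (c t) v).
Proof.
  intros hc hd. apply is_derive_R3 in hc. apply is_derive_R3 in hd.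
  destruct hc as (c1 & c2 & c3), hd as (d1 & d2 & d3). apply is_derive_R3.
  assert (minor : forall f1 g1 f2 g2 a1 b1 a2 b2,
    is_derive f1 t a1 -> is_derive g1 t b1 -> is_derive f2 t a2 -> is_derive g2 t b2 ->
    is_derive (fun x => f1 x * g1 x - f2 x * g2 x) t
      (a1 * g1 t - a2 * g2 t + (f1 t * b1 - f2 t * b2))).
  { intros f1 g1 f2 g2 a1 b1 a2 b2 h1 k1 h2 k2.
    apply (is_derive_eq _ _ _ _ (is_derive_minus_R _ _ _ _ _
      (is_derive_mult_R _ _ _ _ _ h1 k1) (is_derive_mult_R _ _ _ _ _ h2 k2))).
    ring. }
  split; [|split].
  - exact (minor _ _ _ _ _ _ _ _ c2 d3 c3 d2).
  - exact (minor _ _ _ _ _ _ _ _ c3 d1 c1 d3).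
  - exact (minor _ _ _ _ _ _ _ _ c1 d2 c2 d1).
Qed.

Lemma is_derive_scal_fun (a : R -> R) (c : R -> R3) t a' u :
  is_derive a t a' -> is_derive c t u ->
  is_derive (fun x => a x *v c x) t (a' *v c t +v a t *v u).
Proof.
  intros ha hc. apply is_derive_R3 in hc. destruct hc as (? & ? & ?).
  apply is_derive_R3. split; [|split]; coords; apply is_derive_mult_R; trivial.
Qed.

Section SmoothCurves.
Context {I : R -> Prop} (op : open I).

Lemma smooth_dot c d :
  smooth_curve_on I c -> smooth_curve_on I d -> smooth_on I (fun t => dot (c t) (d t)).
Proof.
  intros (? & ? & ?) (? & ? & ?). unfold dot.
  apply smooth_plus; trivial; [apply smooth_plus; trivial|];
    now apply smooth_mult.
Qed.

Lemma smooth_cross c d :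
  smooth_curve_on I c -> smooth_curve_on I d ->
  smooth_curve_on I (fun t => cross (c t) (d t)).
Proof.
  intros (? & ? & ?) (? & ? & ?). unfold cross.
  split; [|split]; simpl; apply smooth_minus; trivial; now apply smooth_mult.
Qed.

Lemma smooth_scal a c :
  smooth_on I a -> smooth_curve_on I c -> smooth_curve_on I (fun t => a t *v c t).
Proof.
  intros ha (? & ? & ?). split; [|split]; now apply smooth_mult.
Qed.

Lemma smooth_velocity c : smooth_curve_on I c -> smooth_curve_on I (velocity c).
Proof.
  intros (? & ? & ?). split; [|split]; now apply smooth_Derive.
Qed.

Lemma smooth_curve_comp (J : R -> Prop) c h :
  (forall t, I t -> J (h t)) -> smooth_curve_on J c -> smooth_on I h ->
  smooth_curve_on I (fun t => c (h t)).
Proof.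
  intros ij (hx & hy & hz) hh.
  split; [|split];
  [apply (smooth_comp op J (fun t => cx (c t)))
  |apply (smooth_comp op J (fun t => cy (c t)))
  |apply (smooth_comp op J (fun t => cz (c t)))]; trivial.
Qed.

End SmoothCurves.

Section Frenet.
Context {I : R -> Prop} {c : R -> R3} (fc : frenet_curve I c).

Lemma frenet_open : open I.
Proof. apply fc. Qed.

Let op := frenet_open.

Lemma smooth_frT : smooth_curve_on I (frT c).
Proof. apply smooth_velocity; trivial. apply fc. Qed.

Lemma smooth_acceleration : smooth_curve_on I (velocity (frT c)).
Proof. apply smooth_velocity; trivial. exact smooth_frT. Qed.

Lemma acceleration_sqr s : I s -> 0 < dot (velocity (frT c) s) (velocity (frT c) s).
Proof.
  intros hs. rewrite <- enorm_sqr. change (0 < curvature c s * curvature c s).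
  apply Rmult_lt_0_compat; now apply fc.
Qed.

Lemma smooth_curvature : smooth_on I (curvature c).
Proof.
  apply smooth_sqrt; trivial; [exact acceleration_sqr|].
  apply smooth_dot; trivial; exact smooth_acceleration.
Qed.

Lemma curvature_neq0 s : I s -> curvature c s <> 0.
Proof. intros hs. apply Rgt_not_eq. now apply fc. Qed.

Lemma smooth_frN : smooth_curve_on I (frN c).
Proof.
  apply smooth_scal; trivial; [|exact smooth_acceleration].
  apply smooth_inv; trivial; [exact curvature_neq0|exact smooth_curvature].
Qed.

Lemma smooth_frB : smooth_curve_on I (frB c).
Proof. apply smooth_cross; trivial; [exact smooth_frT|exact smooth_frN]. Qed.

Lemma smooth_torsion : smooth_on I (torsion c).
Proof.
  apply smooth_dot; trivial; [|exact smooth_frB].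
  apply smooth_velocity; trivial. exact smooth_frN.
Qed.

Lemma acceleration_eq s : I s -> velocity (frT c) s = curvature c s *v frN c s.
Proof.
  intros hs.  pose proof (curvature_neq0 s hs). vec_eq; unfold frN; coords; now field.
Qed.

Lemma frT_derive s : I s -> is_derive (frT c) s (curvature c s *v frN c s).
Proof.
  intros hs. rewrite <- acceleration_eq by trivial.
  apply (smooth_curve_is_derive I); trivial. exact smooth_frT.
Qed.

Lemma dot_frT s : I s -> dot (frT c s) (frT c s) = 1.
Proof.
  intros hs. rewrite <- enorm_sqr. unfold frT. destruct fc as (_ & _ & un & _).
  rewrite un; trivial. ring.
Qed.

Lemma dot_frN s : I s -> dot (frN c s) (frN c s) = 1.
Proof.
  intros hs. unfold frN. rewrite dot_scal_l, dot_comm, dot_scal_l, <- enorm_sqr.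
  change (enorm (velocity (frT c) s)) with (curvature c s).
  field. now apply curvature_neq0.
Qed.

(** Applied to the orthonormality relations, this yields the components of the derivatives of the
    frame vectors. *)
Lemma constant_dot (u v : R -> R3) a s du dv :
  I s -> (forall x, I x -> dot (u x) (v x) = a) ->
  is_derive u s du -> is_derive v s dv -> dot du (v s) + dot (u s) dv = 0.
Proof.
  intros hs hc hu hv.
  pose proof (is_derive_unique _ _ _ (is_derive_dot _ _ _ _ _ hu hv)) as e.
  rewrite <- e. apply is_derive_unique, (is_derive_ext_loc (fun _ => a)).
  - apply (filter_imp I); [|now apply op]. intros x hx. symmetry. now apply hc.
  - apply @is_derive_const.
Qed.

Lemma dot_frT_frN s : I s -> dot (frT c s) (frN c s) = 0.
Proof.
  intros hs. pose proof (frT_derive s hs) as h.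
  pose proof (constant_dot _ _ 1 s _ _ hs dot_frT h h) as e.
  rewrite (dot_comm (frT c s)), dot_scal_l, (dot_comm (frN c s)) in e.
  apply Rmult_eq_reg_l with (curvature c s); [lra|now apply curvature_neq0].
Qed.

Lemma dot_frB s : I s -> dot (frB c s) (frB c s) = 1.
Proof.
  intros hs. unfold frB.
  rewrite dot_self_cross, dot_frT, dot_frN, dot_frT_frN by trivial. ring.
Qed.

Lemma dot_frT_frB s : dot (frT c s) (frB c s) = 0.
Proof. apply dot_cross_l. Qed.

Lemma dot_frN_frB s : dot (frN c s) (frB c s) = 0.
Proof. apply dot_cross_r. Qed.

(** The derivative has no component along [N] because [N.N = 1]; the one along [T] is minus the
    curvature because [T.N = 0]; the one along [B] is the torsion by definition. *)
Lemma frN_derive s : I s ->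
  is_derive (frN c) s ((- curvature c s) *v frT c s +v torsion c s *v frB c s).
Proof.
  intros hs. pose proof (smooth_curve_is_derive I _ s smooth_frN hs) as h.
  pose proof (constant_dot _ _ 1 s _ _ hs dot_frN h h) as e1.
  pose proof (constant_dot _ _ 0 s _ _ hs dot_frT_frN (frT_derive s hs) h) as e2.
  rewrite (dot_comm (frN c s)) in e1. rewrite dot_scal_l, dot_frN in e2 by trivial.
  replace ((- curvature c s) *v frT c s +v torsion c s *v frB c s)
    with (velocity (frN c) s); trivial.
  rewrite (orthonormal_expansion (frT c s) (frN c s) (velocity (frN c) s)
    (dot_frT s hs) (dot_frN s hs) (dot_frT_frN s hs)).
  replace (dot (velocity (frN c) s) (frN c s)) with 0 by lra.
  rewrite (dot_comm (velocity (frN c) s) (frT c s)).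
  replace (dot (frT c s) (velocity (frN c) s)) with (- curvature c s) by lra.
  vec_eq; unfold torsion, frB; coords; ring.
Qed.

Lemma frB_derive s : I s -> is_derive (frB c) s ((- torsion c s) *v frN c s).
Proof.
  intros hs.
  pose proof (is_derive_cross _ _ _ _ _ (frT_derive s hs) (frN_derive s hs)) as h.
  replace ((- torsion c s) *v frN c s) with
    (cross (curvature c s *v frN c s) (frN c s) +v
     cross (frT c s) ((- curvature c s) *v frT c s +v torsion c s *v frB c s)); [exact h|].
  (* T x (T x N) = (T.N) T - (T.T) N *)
  transitivity (torsion c s *v (dot (frT c s) (frN c s) *v frT c s
     -v dot (frT c s) (frT c s) *v frN c s)).
  - vec_eq; unfold frB, dot; repeat (progress coords); ring.
  - rewrite dot_frT, dot_frT_frN by trivial. vec_eq; ring.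
Qed.

End Frenet.

(** * Linear combinations of the Frenet frame *)

(** The coefficients are numbers, a moving combination being [comb c (a t) (b t) (d t) t]. Equality
    of two combinations at a point then reduces by [f_equal] to three scalar identities. *)
Definition comb (c : R -> R3) (a b d : R) (t : R) : R3 :=
  a *v frT c t +v b *v frN c t +v d *v frB c t.

Section Comb.
Context {I : R -> Prop} {c : R -> R3} (fc : frenet_curve I c).

Lemma dot_comb a b d a' b' d' t : I t ->
  dot (comb c a b d t) (comb c a' b' d' t) = a * a' + b * b' + d * d'.
Proof.
  intros ht.
  transitivity (a * a' * dot (frT c t) (frT c t) + b * b' * dot (frN c t) (frN c t)
    + d * d' * dot (frB c t) (frB c t) + (a * b' + b * a') * dot (frT c t) (frN c t)
    + (a * d' + d * a') * dot (frT c t) (frB c t)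
    + (b * d' + d * b') * dot (frN c t) (frB c t)).
  - unfold comb, dot. repeat (progress coords). ring.
  - rewrite (dot_frT fc), (dot_frN fc), (dot_frB fc), (dot_frT_frN fc), dot_frT_frB,
      dot_frN_frB by trivial. ring.
Qed.

(** By bilinearity only the products of frame vectors matter. As [B] is [T x N], the products
    [N x B] and [B x T] are double cross products, which the triple product formula and
    orthonormality turn into [T] and [N]. *)
Lemma cross_comb a b d a' b' d' t : I t ->
  cross (comb c a b d t) (comb c a' b' d' t) =
  comb c (b * d' - d * b') (d * a' - a * d') (a * b' - b * a') t.
Proof.
  intros ht.
  pose proof (dot_frT fc t ht) as tt. pose proof (dot_frN fc t ht) as nn.
  pose proof (dot_frT_frN fc t ht) as tn.
  transitivity ((b * d' - d * b') *v (dot (frN c t) (frN c t) *v frT c t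
                    -v dot (frT c t) (frN c t) *v frN c t)
    +v (d * a' - a * d') *v (dot (frT c t) (frT c t) *v frN c t
                    -v dot (frT c t) (frN c t) *v frT c t)
    +v (a * b' - b * a') *v frB c t).
  - unfold comb, frB. vec_eq; unfold dot; ring.
  - rewrite tt, nn, tn. unfold comb. vec_eq; ring.
Qed.

Lemma comb_derive (a b d : R -> R) a' b' d' t :
  I t -> is_derive a t a' -> is_derive b t b' -> is_derive d t d' ->
  is_derive (fun x => comb c (a x) (b x) (d x) x) t
    (comb c (a' - curvature c t * b t)
            (b' + curvature c t * a t - torsion c t * d t)
            (d' + torsion c t * b t) t).
Proof.
  intros ht ha hb hd.
  pose proof (is_derive_scal_fun _ _ _ _ _ ha (frT_derive fc t ht)) as h1.
  pose proof (is_derive_scal_fun _ _ _ _ _ hb (frN_derive fc t ht)) as h2.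
  pose proof (is_derive_scal_fun _ _ _ _ _ hd (frB_derive fc t ht)) as h3.
  pose proof (@is_derive_plus _ _ _ _ _ _ _ (@is_derive_plus _ _ _ _ _ _ _ h1 h2) h3) as h.
  unfold comb at 1. match type of h with is_derive _ _ ?l =>
    replace (comb c (a' - curvature c t * b t)
      (b' + curvature c t * a t - torsion c t * d t) (d' + torsion c t * b t) t) with l end;
  [exact h|]. unfold comb. vec_eq; ring.
Qed.

End Comb.

(** * Bertrand mates and the principal normal indicatrix *)

Lemma constant_on (I : R -> Prop) (f : R -> R) :
  open_interval I -> (forall t, I t -> is_derive f t 0) ->
  forall x y, I x -> I y -> f x = f y.
Proof.
  intros (_ & _ & conv) hf.
  assert (lt : forall x y, I x -> I y -> x < y -> f x = f y).
  { intros x y hx hy xy. apply (eq_is_derive f); trivial.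
    intros t ht. apply hf. now apply (conv x t y). }
  intros x y hx hy. destruct (Rtotal_order x y) as [l|[->|l]]; trivial.
  - now apply lt.
  - symmetry. now apply lt.
Qed.

Lemma sign_sqr (eps : R) : eps = 1 \/ eps = -1 -> eps * eps = 1.
Proof. intros [-> | ->]; ring. Qed.

(* For mates, [T] makes constant angles with [T'] and [B'].  Differentiating
   [gamma' = gamma + lam N] and taking components gives the Bertrand relation
   [(1 + lam eps k) c2 + lam eps tau c1 = 0], where [c1 = T.T'], [c2 = T.B'];
   its derivative shows that [tau' / k'] is the constant [- c2 / c1]. *)
Lemma bertrand_deriv_ratio_constant (I I' : R -> Prop) (c c' : R -> R3)
    (h k ds : R -> R) (eps lam : R) :
  frenet_curve I c -> frenet_curve I' c' ->
  bertrand_mates I c I' c' h k eps lam -> non_planar I' c' ->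
  (forall t, I' t -> Derive (curvature c') t <> 0) ->
  (forall t, I' t -> is_derive k t (ds t)) ->
  exists g, forall t, I' t -> tc_deriv_ratio c' t = g.
Proof.
  intros fc fc' ((_ & kI) & he & lam0 & hN & hpos) np k1 hk.
  pose proof (sign_sqr eps he) as ee.
  assert (hN' : forall t, I' t -> frN c (k t) = eps *v frN c' t).
  { intros t ht. destruct (kI t ht) as [h1 h2]. rewrite hN, h2; trivial. }
  (* The tangent of the original curve, carried to the arclength of the mate. *)
  set (X := fun t => frT c (k t)).
  assert (hX : forall t, I' t ->
    is_derive X t ((ds t * curvature c (k t) * eps) *v frN c' t)).
  { intros t ht. destruct (kI t ht) as [h1 h2].
    pose proof (is_derive_comp (frT c) k t _ _ (frT_derive fc _ h1) (hk t ht)) as d.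
    rewrite hN' in d by trivial.
    replace ((ds t * curvature c (k t) * eps) *v frN c' t)
      with (ds t *v (curvature c (k t) *v (eps *v frN c' t))); [exact d|].
    vec_eq; ring. }
  assert (XN : forall t, I' t -> dot (X t) (frN c' t) = 0).
  { intros t ht. destruct (kI t ht) as [h1 h2].
    pose proof (dot_frT_frN fc _ h1) as e. rewrite hN' in e by trivial.
    rewrite dot_comm, dot_scal_l, dot_comm in e. fold (X t) in e.
    replace (dot (X t) (frN c' t)) with (eps * (eps * dot (X t) (frN c' t))).
    - rewrite e. ring.
    - rewrite <- Rmult_assoc, ee. ring. }
  destruct (fc') as ((op' & (t0 & ht0) & _) & _).
  (* The derivatives of [X] and of the mate's tangent both lie along the mate's normal, which is
     orthogonal to [frT c'] and to [X]. The same holds for the binormal in place of the tangent. *)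
  assert (cT : forall t, I' t -> dot (X t) (frT c' t) = dot (X t0) (frT c' t0)).
  { intros t ht. apply (constant_on I' (fun t => dot (X t) (frT c' t))); trivial; [apply fc'|].
    intros x hx. apply (is_derive_eq _ _ _ _
      (is_derive_dot _ _ _ _ _ (hX x hx) (frT_derive fc' x hx))).
    rewrite (dot_comm (X x)), !dot_scal_l, (dot_comm _ (X x)), XN, dot_comm,
      (dot_frT_frN fc') by trivial. ring. }
  assert (cB : forall t, I' t -> dot (X t) (frB c' t) = dot (X t0) (frB c' t0)).
  { intros t ht. apply (constant_on I' (fun t => dot (X t) (frB c' t))); trivial; [apply fc'|].
    intros x hx. apply (is_derive_eq _ _ _ _
      (is_derive_dot _ _ _ _ _ (hX x hx) (frB_derive fc' x hx))).
    rewrite (dot_comm (X x)), !dot_scal_l, (dot_comm _ (X x)), XN,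
      dot_frN_frB by trivial. ring. }
  set (c1 := dot (X t0) (frT c' t0)) in *. set (c2 := dot (X t0) (frB c' t0)) in *.
  (* Differentiates [c' t = c (k t) + lam eps frN c' t]. The components of the result along the
     mate's own tangent and binormal are the two scalar equations of [comps]. *)
  assert (dpos : forall t, I' t -> frT c' t = ds t *v X t +v
    (lam * eps) *v ((- curvature c' t) *v frT c' t +v torsion c' t *v frB c' t)).
  { intros t ht. destruct (kI t ht) as [h1 h2]. apply velocity_unique.
    apply (is_derive_ext_loc (fun x => c (k x) +v (lam * eps) *v frN c' x)).
    - apply (filter_imp I'); [|now apply op']. intros x hx.
      destruct (kI x hx) as [h3 h4].
      transitivity (c' (h (k x))); [|now rewrite h4].
      rewrite hpos, hN' by trivial. vec_eq; ring.
    - apply @is_derive_plus.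
      + apply (is_derive_comp c k); [|now apply hk].
        apply (smooth_curve_is_derive I); trivial. apply fc.
      + pose proof (is_derive_scal_fun (fun _ => lam * eps) _ t 0 _
          (is_derive_const (lam * eps) t) (frN_derive fc' t ht)) as d.
        match type of d with is_derive _ _ ?l => match goal with
          |- is_derive _ _ ?m => replace m with l end end; [exact d|].
        vec_eq; ring. }
  assert (comps : forall t, I' t ->
    1 = ds t * c1 - lam * eps * curvature c' t /\
    0 = ds t * c2 + lam * eps * torsion c' t).
  { intros t ht. rewrite <- (cT t ht), <- (cB t ht).
    pose proof (dpos t ht) as e. pose proof (dot_frT fc' t ht) as tt.
    pose proof (dot_frT_frB (c := c') t) as tb. pose proof (dot_frB fc' t ht) as bb.
    assert (lin : forall v, dot (frT c' t) v = ds t * dot (X t) v + lam * eps *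
      (- curvature c' t * dot (frT c' t) v + torsion c' t * dot (frB c' t) v)).
    { intros v. rewrite e at 1. unfold dot. repeat (progress coords). ring. }
    pose proof (lin (frT c' t)) as e1. pose proof (lin (frB c' t)) as e2.
    rewrite tt, (dot_comm (frB c' t)), tb in e1. rewrite tb, bb in e2. lra. }
  assert (ne : lam * eps <> 0).
  { intros e. apply lam0. rewrite <- (Rmult_1_r lam), <- ee, <- Rmult_assoc, e. ring. }
  assert (c2n : c2 <> 0).
  { intros e. destruct (comps t0 ht0) as [_ e2]. rewrite e in e2.
    apply (Rmult_integral_contrapositive (lam * eps) (torsion c' t0)); [|lra].
    split; trivial. now apply np. }
  assert (rel : forall t, I' t ->
    Derive (curvature c') t * c2 + Derive (torsion c') t * c1 = 0).
  { intros t ht.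
    pose proof (smooth_is_derive _ t (smooth_curvature fc') ht) as dk.
    pose proof (smooth_is_derive _ t (smooth_torsion fc') ht) as dt.
    pose proof (is_derive_plus_R _ _ _ _ _
      (is_derive_scal _ _ (lam * eps * c2) _ dk)
      (is_derive_scal _ _ (lam * eps * c1) _ dt)) as d.
    apply is_derive_unique in d.
    assert (e : lam * eps * c2 * Derive (curvature c') t +
                lam * eps * c1 * Derive (torsion c') t = 0).
    { rewrite <- d. apply is_derive_unique, (is_derive_ext_loc (fun _ => - c2)).
      - apply (filter_imp I'); [|now apply op']. intros x hx.
        destruct (comps x hx) as [e1 e2].
        (* Multiplying the first equation by [c2] and the second by [c1] eliminates [ds x]; what
           remains says that the differentiated combination is the constant [- c2]. *)
        assert (c2 * (ds x * c1 - lam * eps * curvature c' x) =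
          c2 + c1 * (ds x * c2 + lam * eps * torsion c' x)) by (rewrite <- e1, <- e2; ring).
        simpl. lra.
      - apply @is_derive_const. }
    apply Rmult_eq_reg_l with (lam * eps); trivial. lra. }
  exists (- c2 / c1). intros t ht.
  assert (c1n : c1 <> 0).
  { intros e. specialize (rel t ht). rewrite e, Rmult_0_r, Rplus_0_r in rel.
    apply Rmult_integral in rel. destruct rel; [now apply (k1 t)|contradiction]. }
  unfold tc_deriv_ratio. specialize (rel t ht). specialize (k1 t ht).
  apply Rmult_eq_reg_r with (c1 * Derive (curvature c') t).
  2: now apply Rmult_integral_contrapositive.
  field_simplify; trivial. lra.
Qed.

(** * Frenet apparatus of the principal normal indicatrix *)

Ltac nonzero := repeat split; first [assumption | lra].

(** The normal moves with speed [sqrt (k^2 + tau^2) = k sqrt (1 + f^2)] along the curve; this is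
    that speed divided by the curvature. *)
Definition speed (c : R -> R3) (t : R) : R := sqrt (1 + tc_ratio c t ^ 2).

(** [c] plays the part of the mate, and [p] sends the arclength of the indicatrix to that of [c]. *)
Definition indicatrix (c : R -> R3) (eps : R) (p : R -> R) (u : R) : R3 :=
  eps *v frN c (p u).

Section Indicatrix.
Context {I : R -> Prop} {c : R -> R3} (fc : frenet_curve I c).
Context {g : R} (hg : forall t, I t -> tc_deriv_ratio c t = g).
Context (k1_neq0 : forall t, I t -> Derive (curvature c) t <> 0).
Context {eps : R} (eps_sqr : eps * eps = 1).
Context {J : R -> Prop} {p : R -> R} (oj : open_interval J).
Context (smooth_p : smooth_on J p) (pJ : forall u, J u -> I (p u)).
Context (dp : forall u, J u -> is_derive p u (/ (curvature c (p u) * speed c (p u)))).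

Let cn := indicatrix c eps p.
Let k := curvature c.
Let k1 := Derive k.
Let f := tc_ratio c.
Let w := speed c.
Let r := rho c.
(** By the quotient rule and [tau' = g k1], this is [k] times the derivative of [f]. *)
Let m t := k1 t * (g - f t).

Let opI : open I := frenet_open fc.

Lemma speed_sqr t : speed c t * speed c t = 1 + tc_ratio c t ^ 2.
Proof. apply sqrt_sqrt. pose proof (pow2_ge_0 (tc_ratio c t)). lra. Qed.

Lemma speed_pos t : 0 < speed c t.
Proof. apply sqrt_lt_R0. pose proof (pow2_ge_0 (tc_ratio c t)). lra. Qed.

Lemma rho_arg_pos t : I t ->
  0 < Derive (curvature c) t ^ 2 * (tc_deriv_ratio c t - tc_ratio c t) ^ 2
      + curvature c t ^ 4 * (1 + tc_ratio c t ^ 2) ^ 3.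
Proof.
  intros ht. assert (kp : 0 < curvature c t) by now apply fc.
  pose proof (pow2_ge_0 (tc_ratio c t)).
  assert (0 < curvature c t ^ 4 * (1 + tc_ratio c t ^ 2) ^ 3).
  { apply Rmult_lt_0_compat; apply pow_lt; lra. }
  rewrite <- Rpow_mult_distr. pose proof (pow2_ge_0
    (Derive (curvature c) t * (tc_deriv_ratio c t - tc_ratio c t))). lra.
Qed.

Lemma rho_pos t : I t -> 0 < rho c t.
Proof. intros ht. now apply sqrt_lt_R0, rho_arg_pos. Qed.

Lemma rho_sqr t : I t -> r t * r t = m t ^ 2 + k t ^ 4 * w t ^ 6.
Proof.
  intros ht. unfold r, rho. rewrite sqrt_sqrt by now apply Rlt_le, rho_arg_pos.
  rewrite hg by trivial. unfold m, k1, k, w, f. rewrite <- speed_sqr. ring.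
Qed.

Lemma smooth_tc_ratio : smooth_on I (tc_ratio c).
Proof.
  apply smooth_div; trivial.
  - exact (curvature_neq0 fc).
  - exact (smooth_torsion fc).
  - exact (smooth_curvature fc).
Qed.

Lemma smooth_rho : smooth_on I (rho c).
Proof.
  pose proof (smooth_curvature fc) as sk. pose proof smooth_tc_ratio as sf.
  apply smooth_sqrt; trivial; [exact rho_arg_pos|].
  apply smooth_plus; trivial; apply smooth_mult; trivial; apply smooth_pow; trivial.
  - now apply smooth_Derive.
  - apply smooth_minus; trivial. apply smooth_ext with (fun _ => g); trivial.
    + intros t ht. symmetry. now apply hg.
    + now apply smooth_const.
  - apply smooth_plus; trivial; [now apply smooth_const|now apply smooth_pow].
Qed.

Lemma torsion_ratio t : I t -> torsion c t = k t * f t.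
Proof. intros ht. unfold k, f, tc_ratio. field. now apply (curvature_neq0 fc). Qed.

Lemma tc_ratio_derive t : I t -> is_derive f t (m t / k t).
Proof.
  intros ht. pose proof (curvature_neq0 fc t ht) as kn.
  pose proof (smooth_is_derive _ t (smooth_curvature fc) ht) as dk.
  pose proof (smooth_is_derive _ t (smooth_torsion fc) ht) as dt.
  apply (is_derive_eq _ _ _ _ (is_derive_div _ _ _ _ _ dt dk kn)).
  assert (e : Derive (torsion c) t = g * k1 t).
  { rewrite <- (hg t ht). unfold tc_deriv_ratio, k1, k. field. now apply k1_neq0. }
  rewrite e, torsion_ratio by trivial. unfold m, k1, k in *. now field.
Qed.

Lemma speed_sqr_derive t : I t ->
  is_derive (fun t => 1 + f t ^ 2) t (2 * f t * (m t / k t)).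
Proof.
  intros ht. apply (is_derive_eq _ _ _ _ (is_derive_plus_R _ _ _ _ _
    (is_derive_const 1 t) (is_derive_pow f 2 t _ (tc_ratio_derive t ht)))).
  unfold zero; simpl. ring.
Qed.

Lemma speed_derive t : I t -> is_derive w t (f t * (m t / k t) / w t).
Proof.
  intros ht. pose proof (speed_pos t) as wp. fold w in wp.
  assert (pos : 0 < 1 + f t ^ 2) by (pose proof (pow2_ge_0 (f t)); lra).
  apply (is_derive_eq _ _ _ _ (is_derive_sqrt _ _ _ (speed_sqr_derive t ht) pos)).
  change (sqrt (1 + f t ^ 2)) with (w t). field.
  split; [now apply (curvature_neq0 fc)|lra].
Qed.

Lemma speed_inv_derive t : I t ->
  is_derive (fun t => / w t) t (- (f t * (m t / k t) / w t) / w t ^ 2).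
Proof.
  intros ht. apply is_derive_inv; [now apply speed_derive|].
  apply Rgt_not_eq, speed_pos.
Qed.

Lemma comb_comp_derive (a b d : R -> R) a' b' d' u :
  J u -> is_derive a (p u) a' -> is_derive b (p u) b' -> is_derive d (p u) d' ->
  is_derive (fun u => comb c (a (p u)) (b (p u)) (d (p u)) (p u)) u
    (comb c ((a' - k (p u) * b (p u)) / (k (p u) * w (p u)))
            ((b' + k (p u) * a (p u) - torsion c (p u) * d (p u)) / (k (p u) * w (p u)))
            ((d' + torsion c (p u) * b (p u)) / (k (p u) * w (p u))) (p u)).
Proof.
  intros hu ha hb hd.
  pose proof (is_derive_comp _ p u _ _
    (comb_derive fc a b d a' b' d' (p u) (pJ u hu) ha hb hd) (dp u hu)) as h.
  match type of h with is_derive _ _ ?l => match goal with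
    |- is_derive _ _ ?m => replace m with l end end; [exact h|].
  unfold comb, Rdiv. vec_eq; fold k w; ring.
Qed.

Lemma indicatrix_smooth : smooth_curve_on J cn.
Proof.
  assert (oJ : open J) by apply oj.
  apply (smooth_scal oJ (fun _ => eps) (fun u => frN c (p u))).
  - now apply smooth_const.
  - apply (smooth_curve_comp oJ I); trivial. exact (smooth_frN fc).
Qed.

(** The derivative [- k T + tau B] of the normal is divided by [k w]; with [tau = k f] the curvature
    cancels. *)
Lemma indicatrix_frT u : J u ->
  frT cn u = comb c (- eps / w (p u)) 0 (eps * f (p u) / w (p u)) (p u).
Proof.
  intros hu. apply velocity_unique.
  apply (is_derive_ext (fun u => comb c 0 eps 0 (p u))).
  { intros x. unfold comb, cn, indicatrix. vec_eq; ring. }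
  pose proof (comb_comp_derive (fun _ => 0) (fun _ => eps) (fun _ => 0) 0 0 0 u hu
    (is_derive_const 0 _) (is_derive_const eps _) (is_derive_const 0 _)) as h.
  match type of h with is_derive _ _ ?l => match goal with
    |- is_derive _ _ ?m => replace m with l end end; [exact h|].
  pose proof (pJ u hu) as ht. pose proof (curvature_neq0 fc _ ht) as kn. fold k in kn.
  pose proof (speed_pos (p u)) as wp. fold w in wp.
  rewrite torsion_ratio by trivial. f_equal; field; nonzero.
Qed.

Lemma indicatrix_unit u : J u -> enorm (velocity cn u) = 1.
Proof.
  intros hu. change (velocity cn u) with (frT cn u). rewrite indicatrix_frT by trivial.
  pose proof (pJ u hu) as ht. unfold enorm. rewrite (dot_comb fc) by trivial.
  pose proof (speed_pos (p u)) as wp. pose proof (speed_sqr (p u)) as ws. fold w f in wp, ws.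
  rewrite <- sqrt_1. f_equal.
  (* [field] treats [w] and [eps] as atoms, so the intermediate form isolates [eps * eps] and
     [1 + f^2], to be rewritten with [eps_sqr] and [ws]. The same device recurs in the computations
     below. *)
  transitivity (eps * eps * (1 + f (p u) ^ 2) / (w (p u) * w (p u))); [field; nonzero|].
  rewrite eps_sqr, <- ws. field. nonzero.
Qed.

Lemma indicatrix_acceleration u : J u ->
  velocity (frT cn) u =
  comb c (eps * f (p u) * m (p u) / (k (p u) ^ 2 * w (p u) ^ 4)) (- eps)
         (eps * m (p u) / (k (p u) ^ 2 * w (p u) ^ 4)) (p u).
Proof.
  intros hu. pose proof (pJ u hu) as ht. apply velocity_unique.
  pose proof (curvature_neq0 fc _ ht) as kn. fold k in kn.
  pose proof (speed_pos (p u)) as wp. pose proof (speed_sqr (p u)) as ws. fold w f in wp, ws.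
  apply (is_derive_ext_loc (fun u =>
    comb c (- eps * / w (p u)) 0 (eps * (f (p u) * / w (p u))) (p u))).
  { apply (filter_imp J); [|now apply oj]. intros x hx.
    rewrite indicatrix_frT by trivial. f_equal. unfold Rdiv. ring. }
  pose proof (comb_comp_derive _ (fun _ => 0) _ _ 0 _ u hu
    (is_derive_scal _ _ (- eps) _ (speed_inv_derive _ ht))
    (is_derive_const 0 _)
    (is_derive_scal _ _ eps _ (is_derive_mult_R _ _ _ _ _
      (tc_ratio_derive _ ht) (speed_inv_derive _ ht)))) as h.
  match type of h with is_derive _ _ ?l => match goal with
    |- is_derive _ _ ?m => replace m with l end end; [exact h|].
  rewrite torsion_ratio by trivial. f_equal.
  - field. nonzero.
  - transitivity (- eps * (1 + f (p u) ^ 2) / (w (p u) * w (p u))); [field; nonzero|].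
    rewrite <- ws. field. nonzero.
  (* The relation [w^2 - f^2 = 1] collapses the derivative of [f / w] to [m / (k w^3)]. *)
  - transitivity (eps * m (p u) * (w (p u) * w (p u) - f (p u) ^ 2) /
      (k (p u) ^ 2 * w (p u) ^ 4)); [field; nonzero|].
    rewrite ws. field. nonzero.
Qed.

(** In the squared acceleration the [T] and [B] components add up to [m^2 (1 + f^2) / (k^4 w^8) =
    m^2 / (k^4 w^6)] and the [N] component gives 1; over the common denominator the numerator is the
    square of [rho]. *)
Lemma indicatrix_curvature u : J u ->
  curvature cn u = r (p u) / (k (p u) ^ 2 * w (p u) ^ 3).
Proof.
  intros hu. pose proof (pJ u hu) as ht. unfold curvature at 1, enorm.
  rewrite indicatrix_acceleration, (dot_comb fc) by trivial.
  assert (kp : 0 < k (p u)) by now apply fc.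
  pose proof (speed_pos (p u)) as wp. pose proof (speed_sqr (p u)) as ws. fold w f in wp, ws.
  pose proof (rho_pos _ ht) as rp. fold r in rp. pose proof (rho_sqr _ ht) as rs.
  apply sqrt_lem_1.
  - match goal with |- 0 <= ?x * ?x + ?y * ?y + ?z * ?z =>
      pose proof (Rle_0_sqr x); pose proof (Rle_0_sqr y); pose proof (Rle_0_sqr z) end.
    unfold Rsqr in *. lra.
  - apply Rlt_le, Rdiv_lt_0_compat; trivial. apply Rmult_lt_0_compat; now apply pow_lt.
  - transitivity ((r (p u) * r (p u)) / (k (p u) ^ 4 * w (p u) ^ 6)); [field; nonzero|].
    rewrite rs.
    transitivity (eps * eps * (m (p u) ^ 2 * (1 + f (p u) ^ 2) / (k (p u) ^ 4 * w (p u) ^ 8) + 1));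
      [|field; nonzero].
    rewrite eps_sqr, <- ws. field. nonzero.
Qed.

Lemma indicatrix_frenet : frenet_curve J cn.
Proof.
  split; [|split; [|split]]; trivial.
  - exact indicatrix_smooth.
  - exact indicatrix_unit.
  - intros u hu. pose proof (pJ u hu) as ht. rewrite indicatrix_curvature by trivial.
    assert (kp : 0 < k (p u)) by now apply fc. pose proof (speed_pos (p u)) as wp.
    apply Rdiv_lt_0_compat; [now apply rho_pos|].
    apply Rmult_lt_0_compat; now apply pow_lt.
Qed.

Lemma indicatrix_frN u : J u ->
  frN cn u =
  comb c (eps * f (p u) * m (p u) / (r (p u) * w (p u)))
    (- eps * k (p u) ^ 2 * w (p u) ^ 3 / r (p u))
    (eps * m (p u) / (r (p u) * w (p u))) (p u).
Proof.
  intros hu. pose proof (pJ u hu) as ht. unfold frN at 1.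
  rewrite indicatrix_acceleration, indicatrix_curvature by trivial.
  assert (kp : 0 < k (p u)) by now apply fc.
  pose proof (speed_pos (p u)) as wp. fold w in wp.
  pose proof (rho_pos _ ht) as rp. fold r in rp.
  unfold comb. vec_eq; field; nonzero.
Qed.

Lemma indicatrix_frB u : J u ->
  frB cn u =
  comb c (k (p u) ^ 2 * f (p u) * w (p u) ^ 2 / r (p u)) (m (p u) / r (p u))
    (k (p u) ^ 2 * w (p u) ^ 2 / r (p u)) (p u).
Proof.
  intros hu. pose proof (pJ u hu) as ht. unfold frB at 1.
  rewrite indicatrix_frT, indicatrix_frN, (cross_comb fc) by trivial.
  pose proof (speed_pos (p u)) as wp. pose proof (speed_sqr (p u)) as ws. fold w f in wp, ws.
  pose proof (rho_pos _ ht) as rp. fold r in rp.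
  f_equal.
  - transitivity (eps * eps * (k (p u) ^ 2 * f (p u) * w (p u) ^ 2 / r (p u))); [field; nonzero|].
    rewrite eps_sqr. ring.
  - transitivity (eps * eps * m (p u) * (1 + f (p u) ^ 2) / (w (p u) * w (p u) * r (p u)));
      [field; nonzero|].
    rewrite eps_sqr, <- ws. field. nonzero.
  - transitivity (eps * eps * (k (p u) ^ 2 * w (p u) ^ 2 / r (p u))); [field; nonzero|].
    rewrite eps_sqr. ring.
Qed.

(** The torsion is read off from the third Frenet formula by taking the dot product with the normal,
    so that only the binormal has to be differentiated. With [w^2] written as [1 + f^2], the
    binormal is [/ r] times a vector whose coefficients are polynomials in [k], [k1], [f] and [g].
    The derivative of [/ r] comes multiplied by a vector along the binormal, orthogonal to the
    normal, and cancels. *)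
Lemma indicatrix_torsion u : J u ->
  torsion cn u =
  - eps * (g - f (p u)) / r (p u) ^ 2 *
  ((3 * k1 (p u) ^ 2 - k (p u) * Derive_n k 2 (p u)) * (1 + f (p u) ^ 2)
   + 3 * f (p u) * k1 (p u) ^ 2 * (g - f (p u))).
Proof.
  intros hu. pose proof (pJ u hu) as ht.
  assert (kp : 0 < k (p u)) by now apply fc.
  pose proof (speed_pos (p u)) as wp. pose proof (speed_sqr (p u)) as ws. fold w f in wp, ws.
  pose proof (rho_pos _ ht) as rp. fold r in rp.
  pose proof (smooth_is_derive _ _ (smooth_curvature fc) ht) as dk. fold k k1 in dk.
  pose proof (smooth_is_derive _ _ (smooth_Derive opI _ (smooth_curvature fc)) ht) as dk1.
  change (Derive (Derive (curvature c)) (p u)) with (Derive_n k 2 (p u)) in dk1.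
  fold k k1 in dk1. set (k2 := Derive_n k 2 (p u)) in *.
  pose proof (tc_ratio_derive _ ht) as df.
  pose proof (speed_sqr_derive _ ht) as dw2.
  pose proof (smooth_is_derive _ _ smooth_rho ht) as dr. fold r in dr.
  assert (rn : r (p u) <> 0) by lra.
  pose proof (is_derive_inv _ _ _ dr rn) as dq.
  (* Kept opaque, as it drops out of the final identity. *)
  set (q' := - Derive r (p u) / r (p u) ^ 2) in dq.
  pose proof (is_derive_mult_R _ _ _ _ _ (is_derive_pow k 2 _ _ dk) dw2) as dD.
  pose proof (is_derive_mult_R _ _ _ _ _ dD df) as dA.
  (* Here [g] is differentiated as a constant. *)
  pose proof (is_derive_mult_R _ _ _ _ _ dk1
    (is_derive_minus_R _ _ _ _ _ (is_derive_const g (p u)) df)) as dM.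
  pose proof (comb_comp_derive _ _ _ _ _ _ u hu
    (is_derive_mult_R _ _ _ _ _ dq dA) (is_derive_mult_R _ _ _ _ _ dq dM)
    (is_derive_mult_R _ _ _ _ _ dq dD)) as h.
  simpl in h.
  match type of h with is_derive _ _ ?l => assert (e : velocity (frB cn) u = l) end.
  { apply velocity_unique. refine (is_derive_ext_loc _ _ _ _ _ h).
    apply (filter_imp J); [|now apply oj]. intros x hx.
    rewrite indicatrix_frB by trivial.
    pose proof (speed_sqr (p x)) as wsx. fold w f in wsx.
    replace (w (p x) ^ 2) with (1 + f (p x) ^ 2) by (rewrite <- wsx; ring).
    unfold m. f_equal; unfold Rdiv; ring. }
  rewrite (velocity_unique _ _ _ (frB_derive indicatrix_frenet u hu)) in e.
  assert (e2 : - torsion cn u = dot ((- torsion cn u) *v frN cn u) (frN cn u)).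
  { rewrite dot_scal_l, (dot_frN indicatrix_frenet) by trivial. ring. }
  rewrite e, indicatrix_frN, (dot_comb fc) in e2 by trivial.
  apply Ropp_eq_reg. rewrite e2. clear e e2 h dq dD dA dM dw2 df dk1 dk dr.
  rewrite torsion_ratio by trivial. unfold m, zero. simpl.
  assert (pos : 0 < 1 + f (p u) ^ 2) by (pose proof (pow2_ge_0 (f (p u))); lra).
  (* In each product of components [w] occurs to an even total power. Once these powers are replaced
     by powers of [1 + f^2], [w] is gone and [field] can conclude. *)
  assert (outer : forall x y, x / (k (p u) * w (p u)) * (y / (r (p u) * w (p u))) =
    x * y / (k (p u) * r (p u) * (1 + f (p u) ^ 2))).
  { intros x y. rewrite <- ws. field. nonzero. }
  assert (middle : forall x, x / (k (p u) * w (p u)) *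
    (- eps * (k (p u) * (k (p u) * 1)) * (w (p u) * (w (p u) * (w (p u) * 1))) / r (p u)) =
    - x * eps * k (p u) * (1 + f (p u) ^ 2) / r (p u)).
  { intros x. rewrite <- ws. field. nonzero. }
  rewrite !outer, middle. field. repeat split; lra.
Qed.

End Indicatrix.

(** * Arclength of the indicatrix and conclusion *)

Lemma RInt_derive_on (I : R -> Prop) (f : R -> R) (a s : R) :
  open_interval I -> (forall x, I x -> continuity_pt f x) -> I a -> I s ->
  is_derive (fun x => RInt f a x) s (f s).
Proof.
  intros (op & _ & conv) cf ha hs.
  assert (cf' : forall x, I x -> continuous f x).
  { intros x hx. now apply continuity_pt_filterlim, cf. }
  apply (is_derive_RInt f (fun x => RInt f a x) a s); [|now apply cf'].
  apply (filter_imp I); [|now apply op]. intros x hx.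
  apply (@RInt_correct R_CompleteNormedModule), (@ex_RInt_continuous R_CompleteNormedModule).
  intros z hz. apply cf'. revert hz. apply Rmin_case; apply Rmax_case; intros hz.
  - replace z with a by lra. trivial.
  - now apply (conv a z x).
  - now apply (conv x z a).
  - replace z with x by lra. trivial.
Qed.

Theorem theorem7 :
  forall (I I' : R -> Prop) (gamma gamma' : R -> R3)
    (sstar s_of : R -> R) (eps lam : R),
  frenet_curve I gamma ->
  frenet_curve I' gamma' ->
  bertrand_mates I gamma I' gamma' sstar s_of eps lam ->
  non_helical I gamma -> non_planar I gamma ->
  non_helical I' gamma' -> non_planar I' gamma' ->
  (forall t, I' t -> Derive (curvature gamma') t <> 0) ->
  (forall t, I' t -> tc_ratio gamma' t <> 0) ->
  (forall t, I' t -> tc_deriv_ratio gamma' t <> tc_ratio gamma' t) ->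
  (forall t, I' t -> is_derive s_of t (ds_dsstar gamma' t)) ->
  forall (s0 sn0 : R), I s0 ->
  let sn := fun s : R =>
    sn0 + RInt (fun x : R => dsn_ds gamma' (sstar x)) s0 s in
  (forall s, I s -> is_derive sn s (dsn_ds gamma' (sstar s))) /\
  exists (J : R -> Prop) (gamman : R -> R3),
    arclength_reparam I (frN gamma) sn J gamman /\
    frenet_curve J gamman /\
    (forall s, I s ->
      let t := sstar s in
      let u := sn s in
      let T' := frT gamma' t in
      let N' := frN gamma' t in
      let B' := frB gamma' t in
      let k := curvature gamma' t in
      let k1 := Derive (curvature gamma') t in
      let k2 := Derive_n (curvature gamma') 2 t in
      let f := tc_ratio gamma' t in
      let g := tc_deriv_ratio gamma' t in
      let r := rho gamma' t in
      gamman u = eps *v N' /\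
      frT gamman u = (- eps / sqrt (1 + f ^ 2)) *v (T' -v f *v B') /\
      frN gamman u =
        (eps / (r * sqrt (1 + f ^ 2))) *v
          ((f * k1 * (g - f)) *v T' -v (k ^ 2 * (1 + f ^ 2) ^ 2) *v N'
             +v (k1 * (g - f)) *v B') /\
      frB gamman u =
        (1 / r) *v
          ((k ^ 2 * f * (1 + f ^ 2)) *v T' +v (k1 * (g - f)) *v N'
             +v (k ^ 2 * (1 + f ^ 2)) *v B') /\
      curvature gamman u = r / (k ^ 2 * Rpower (1 + f ^ 2) (3 / 2)) /\
      torsion gamman u =
        - eps * (g - f) / r ^ 2 *
          ((3 * k1 ^ 2 - k * k2) * (1 + f ^ 2)
             + 3 * f * k1 ^ 2 * (g - f))) /\
    (forall u, J u ->
      is_derive (frT gamman) u (curvature gamman u *v frN gamman u) /\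
      is_derive (frN gamman) u
        ((- curvature gamman u) *v frT gamman u
           +v torsion gamman u *v frB gamman u) /\
      is_derive (frB gamman) u ((- torsion gamman u) *v frN gamman u)).
Proof.
  intros I I' c c' sstar s_of eps lam fc fc' mates _ _ _ np k1 f0 gf dsof s0 sn0 hs0 sn.
  destruct (bertrand_deriv_ratio_constant I I' c c' sstar s_of _ eps lam
    fc fc' mates np k1 dsof) as [g hg].
  destruct mates as ((IJ & JI) & he & _ & hN & _).
  pose proof (sign_sqr eps he) as ee.
  pose proof (frenet_open fc) as opI. pose proof (frenet_open fc') as opI'.
  assert (oi : open_interval I) by apply fc. assert (oi' : open_interval I') by apply fc'.
  set (k := curvature c') in *. set (f := tc_ratio c') in *. set (G := tc_deriv_ratio c') in *.
  assert (wg : forall t, 0 < sqrt (1 + G t ^ 2)).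
  { intros t. apply sqrt_lt_R0. pose proof (pow2_ge_0 (G t)). lra. }
  assert (gf' : forall t, I' t -> G t - f t <> 0).
  { intros t ht e. apply (gf t ht). lra. }
  assert (sf : smooth_on I' f) by exact (smooth_tc_ratio fc').
  assert (sG : smooth_on I' G).
  { apply (smooth_ext opI' (fun _ => g)); [|now apply smooth_const].
    intros t ht. symmetry. now apply hg. }
  assert (sgf : smooth_on I' (fun t => G t - f t)) by now apply smooth_minus.
  assert (sqr_smooth : forall h, smooth_on I' h -> smooth_on I' (fun t => sqrt (1 + h t ^ 2))).
  { intros h sh. apply (smooth_sqrt opI' (fun t => 1 + h t ^ 2)).
    - intros t _. pose proof (pow2_ge_0 (h t)). lra.
    - apply (smooth_plus opI' (fun _ => 1)); [now apply smooth_const|now apply smooth_pow]. }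
  assert (sds : smooth_on I' (ds_dsstar c')).
  { apply (smooth_div opI' (fun t => f t * sqrt (1 + G t ^ 2)) (fun t => G t - f t)); trivial.
    apply smooth_mult; trivial. now apply sqr_smooth. }
  assert (den : forall t, I' t -> f t * sqrt (1 + G t ^ 2) <> 0).
  { intros t ht. apply Rmult_integral_contrapositive. split; [now apply f0|].
    apply Rgt_not_eq, wg. }
  assert (sdn : smooth_on I' (dsn_ds c')).
  { apply (smooth_div opI' (fun t => k t * (G t - f t) * sqrt (1 + f t ^ 2))
      (fun t => f t * sqrt (1 + G t ^ 2))); trivial.
    - apply smooth_mult; [trivial| |now apply sqr_smooth].
      apply smooth_mult; trivial. exact (smooth_curvature fc').
    - apply smooth_mult; trivial. now apply sqr_smooth. }
  assert (ds0 : forall t, I' t -> ds_dsstar c' t <> 0).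
  { intros t ht. apply Rmult_integral_contrapositive. split; [now apply den|].
    apply Rinv_neq_0_compat. now apply gf'. }
  assert (dn0 : forall t, I' t -> dsn_ds c' t <> 0).
  { intros t ht. apply Rmult_integral_contrapositive. split.
    - repeat apply Rmult_integral_contrapositive_currified.
      + now apply (curvature_neq0 fc').
      + now apply gf'.
      + apply Rgt_not_eq, (speed_pos t).
    - apply Rinv_neq_0_compat. now apply den. }
  (* Differentiability of [sstar] comes from inverting [s_of]. *)
  destruct (smooth_inverse I' I s_of (ds_dsstar c') sstar oi' opI (conj JI IJ) dsof ds0 sds)
    as [ss dss].
  set (D := fun s => dsn_ds c' (sstar s)).
  assert (sD : smooth_on I D).
  { apply (smooth_comp opI I' (dsn_ds c') sstar); trivial. intros s hs. now apply IJ. }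
  assert (D0 : forall s, I s -> D s <> 0).
  { intros s hs. apply dn0. now apply IJ. }
  assert (cD : forall s, I s -> continuity_pt D s).
  { intros s hs. now apply (@smooth_continuity_pt I). }
  assert (dsn : forall s, I s -> is_derive sn s (D s)).
  { intros s hs. apply (is_derive_eq _ _ _ _ (is_derive_plus_R _ _ _ _ _
      (is_derive_const sn0 s) (RInt_derive_on I D s0 s oi cD hs0 hs))).
    apply Rplus_0_l. }
  split; [exact dsn|].
  (* The domain [J] of the arclength parameter is the image of [I] under [sn], which may be
     decreasing. *)
  destruct (inverse_bijection I sn D oi dsn cD D0) as (oj & sig & cor).
  set (J := fun u => exists x, I x /\ sn x = u) in *.
  destruct (smooth_inverse I J sn D sig oi (proj1 oj) cor dsn D0 sD) as [ssig dsig].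
  (* From the arclength of the indicatrix through [s] to the arclength of the mate. *)
  set (p := fun u => sstar (sig u)).
  assert (pJ : forall u, J u -> I' (p u)).
  { intros u hu. apply IJ. now apply cor. }
  assert (sp : smooth_on J p).
  { apply (smooth_comp (proj1 oj) I sstar sig); trivial. intros u hu. now apply cor. }
  assert (dp : forall u, J u -> is_derive p u (/ (curvature c' (p u) * speed c' (p u)))).
  { intros u hu. destruct (proj2 cor u hu) as [h1 h2]. pose proof (pJ u hu) as ht.
    apply (is_derive_eq _ _ _ _ (is_derive_comp sstar sig u _ _ (dss _ h1) (dsig u hu))).
    change (/ D (sig u) * / ds_dsstar c' (sstar (sig u)) =
      / (curvature c' (p u) * speed c' (p u))).
    rewrite <- Rinv_mult. f_equal. unfold D. fold (p u). unfold dsn_ds, ds_dsstar, speed.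
    fold k f G. field. split; [|split].
    - now apply gf'.
    - apply Rgt_not_eq, wg.
    - now apply f0. }
  assert (cnf := indicatrix_frenet fc' hg k1 ee oj sp pJ dp).
  exists J, (indicatrix c' eps p).
  split; [|split; [exact cnf|split]].
  - split; [|split; [|split; [|split]]].
    + apply (smooth_primitive opI sn D); trivial.
    + intros s hs. rewrite (is_derive_unique _ _ _ (dsn s hs)). now apply D0.
    + now exists sig.
    + intros s hs. unfold indicatrix, p. rewrite (proj2 (proj1 cor s hs)).
      symmetry. now apply hN.
    + apply cnf.
  - intros s hs t u T' N' B' k' k1' k2 f' g' r.
    assert (hu : J u) by now exists s.
    assert (pu : p u = t).
    { unfold p, u. now rewrite (proj2 (proj1 cor s hs)). }
    assert (ht : I' t) by now apply IJ.

    pose proof (indicatrix_frT (eps := eps) fc' pJ dp u hu) as hT.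
    pose proof (indicatrix_frN fc' hg k1 ee oj pJ dp u hu) as hNn.
    pose proof (indicatrix_frB fc' hg k1 ee oj pJ dp u hu) as hB.
    pose proof (indicatrix_curvature fc' hg k1 ee oj pJ dp u hu) as hk.
    pose proof (indicatrix_torsion fc' hg k1 ee oj sp pJ dp u hu) as htau.
    (* The constant [g] is turned back into the value of [tc_deriv_ratio] at [t], which is how the
       formulas are stated. *)
    rewrite pu in hT, hNn, hB, hk, htau. rewrite <- (hg t ht) in hNn, hB, htau.
    rewrite hT, hNn, hB, hk, htau.
    pose proof (speed_pos (c := c') t) as wp. pose proof (speed_sqr (c := c') t) as ws.
    assert (wE : sqrt (1 + f' ^ 2) = speed c' t) by reflexivity.
    pose proof (rho_pos fc' t ht) as rp. fold r in rp.
    assert (kp : k' <> 0) by now apply (curvature_neq0 fc').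
    change (curvature c' t) with k'. change (tc_ratio c' t) with f' in ws |- *.
    change (G t) with g'. change (Derive (curvature c') t) with k1'.
    change (rho c' t) with r. set (w := speed c' t) in *.
    split; [|split; [|split; [|split; [|split]]]].
    + unfold indicatrix. now rewrite pu.
    + rewrite wE. unfold comb. fold T' N' B'. vec_eq; field; nonzero.
    + rewrite wE, <- ws. unfold comb. fold T' N' B'. vec_eq; field; nonzero.
    + rewrite <- ws. unfold comb. fold T' N' B'. vec_eq; field; nonzero.
    (* Splitting the exponent turns the real power into the cube of a square root, that is,
       [w^3]. *)
    + replace (3 / 2) with (/ 2 * INR 3) by (simpl; lra).
      rewrite <- Rpower_mult, Rpower_sqrt, wE, Rpower_pow; trivial.
      rewrite <- ws. now apply Rmult_lt_0_compat.
    + reflexivity.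
  - intros u hu. split; [|split].
    + exact (frT_derive cnf u hu).
    + exact (frN_derive cnf u hu).
    + exact (frB_derive cnf u hu).
Qed.
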